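(* Let $\lambda^+(t,X,Y)$ and $\lambda^-(t,X,Y)$, $t\ge 0$, $X,Y\in\mathcal X$, be Borel measurable, non-negative, bounded functions (no continuity is assumed), and let $\Lambda^\pm[t,X,\mu]=\int_{\mathcal X}\lambda^\pm(t,X,Y)\,\mu(dY)$ for $t\ge0$, $X\in\mathcal X$ and any probability measure $\mu$ on $\mathcal X$. Assume that $\lambda^\pm$ are uniformly bounded away from zero, except that there are no downward jumps from states with zero customers; that is, there is a constant $c>0$ such that $\lambda^+(t,X,Y)\ge c$ for all $t\ge 0$, $X,Y\in\mathcal X$, and $\lambda^-(t,X,Y)\ge c$ for all $t\ge 0$, $Y\in\mathcal X$ and all $X=(k,x,y)\in\mathcal X$ with $k\ge 1$, while $\lambda^-(t,(0,x),Y)=0$ for all $t\ge 0$, $x\ge 0$, $Y\in\mathcal X$. Then for any fixed distribution of $X_0$ on $\mathcal X$ there exists no more than one distribution (on the space of trajectories) of a process $(X_t,\ t\ge 0)$ with intensities of upward and downward jumps $\Lambda^+[t,X_t,\mu_t]$ and $\Lambda^-[t,X_t,\mu_t]$, where $\mu_t$ denotes the distribution of $X_t$.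
   Context: State space: $\mathcal X=\{(0,x): x\ge 0\}\cup\bigcup_{k=1}^\infty\{(k,x,y): x,y\ge 0\}$. Here $k$ is the number of customers in a single-server queue, $x$ is the time elapsed since the last arrival, and $y$ is the elapsed time of the current service. The notation $(0,x,y)$ is also used, with $y$ a false variable: all triples $(0,x,y)$, for any $y$, are identified with $(0,x)$, so functions on $\mathcal X$ do not depend on $y$ when $k=0$; the representative $(0,x,0)$ is used in formulas that need a value of $y$. The space $\mathcal X$ carries the metric $\rho(X,X')=|k-k'|+|x-x'|+|y-y'|$ for $X=(k,x,y)$, $X'=(k',x',y')$, and the corresponding Borel sigma-algebra. For $X=(k,x,y)$: $X^+=(k+1,0,y)$ for $k\ge 0$ (so $(0,x)^+=(1,0,0)$), and $X^-=(k-1,x,0)$ for $k\ge 1$ (so $(1,x,y)^-=(0,x)$). $X^-$ is not defined for $k=0$. $1(\cdot)$ denotes the indicator. A process with intensities $\Lambda^+[t,X_t,\mu_t]$ and $\Lambda^-[t,X_t,\mu_t]$ is a càdlàg $\mathcal X$-valued (possibly time-inhomogeneous) piecewise-linear Markov process $(X_t,\ t\ge 0)$ such that: between any two subsequent jumps the continuous components ($(x,y)$ if $k>0$, just $x$ if $k=0$) grow linearly with rate $1$ while $k$ remains unchanged; jumps take $X$ to $X^+$ or $X^-$; there are finitely many jumps on bounded time intervals; and, with $\mu_t$ the distribution of $X_t$, for any bounded continuous function $g$ on $\mathcal X$ with bounded continuous derivatives in $(x,y)$ (only in $x$ when $k=0$; one-sided at the boundary), the process $$M_t=g(X_t)-g(X_0)-\int_0^t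 L[s,X_s,\mu_s]g(X_s)\,ds,\qquad t\ge 0,$$ is a martingale with respect to the natural filtration of $(X_t)$, where, for $X=(k,x,y)$ and $X'\in\mathcal X$, $$L[t,X',\mu]g(X)=\Lambda^+[t,X',\mu]\,(g(X^+)-g(X))+1(k>0)\,\Lambda^-[t,X',\mu]\,(g(X^-)-g(X))+\frac{\partial}{\partial x}g(k,x,y)+1(k>0)\frac{\partial}{\partial y}g(k,x,y).$$ *)

(* Defs.v *)
From HB Require Import structures.
From mathcomp Require Import all_boot all_order all_algebra.
From mathcomp Require Import all_classical all_reals all_analysis.
Set Implicit Arguments.
Unset Strict Implicit.
Unset Printing Implicit Defensive.
Import Order.TTheory GRing.Theory Num.Theory.
Import numFieldNormedType.Exports.
Local Open Scope classical_set_scope.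
Local Open Scope ring_scope.

(** [Idle x] is (0, x) and [Busy j x y] is (j + 1, x, y). *)
Inductive state (R : realType) :=
| Idle of {nonneg R}
| Busy of nat & {nonneg R} & {nonneg R}.

HB.instance Definition _ (R : realType) := gen_eqMixin (state R).
HB.instance Definition _ (R : realType) := gen_choiceMixin (state R).
HB.instance Definition _ (R : realType) :=
  isPointed.Build (state R) (Idle (0%:nng : {nonneg R})).

Section state_space.
Context {R : realType}.
Implicit Types X : state R.

Definition customers X : nat := if X is Busy j _ _ then j.+1 else 0%N.

Definition since_arrival X : {nonneg R} :=
  match X with Idle x => x | Busy _ x _ => x end.

(** An idle state (0, x) is represented by the triple (0, x, 0). *)
Definition in_service X : {nonneg R} :=
  if X is Busy _ _ y then y else 0%:nng.

(** The triple (k, x, y), in which [y] is a false variable when [k = 0]. *)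
Definition triple (k : nat) (x y : {nonneg R}) : state R :=
  if k is j.+1 then Busy j x y else Idle x.

Definition rho X X' : R :=
  `|(customers X)%:R - (customers X')%:R|
  + `|(since_arrival X)%:num - (since_arrival X')%:num|
  + `|(in_service X)%:num - (in_service X')%:num|.

Let rhoxx X : rho X X = 0.
Proof. by rewrite /rho !subrr normr0 !addr0. Qed.

Let rho_positivity X X' : rho X X' = 0 -> X = X'.
Proof.
rewrite /rho => /eqP; rewrite paddr_eq0 ?addr_ge0// => /andP[+ /eqP hy].
rewrite paddr_eq0// => /andP[/eqP hk /eqP hx].
move: hk hx hy => /normr0P; rewrite subr_eq0 eqr_nat => /eqP hk.
move=> /normr0P; rewrite subr_eq0 => /eqP/val_inj hx.
move=> /normr0P; rewrite subr_eq0 => /eqP/val_inj hy.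
by case: X X' hk hx hy => [x|j x y] [x'|j' x' y'] //= => [_ ->|[->] -> ->].
Qed.

Let rho_sym X X' : rho X X' = rho X' X.
Proof. by rewrite /rho (distrC _%:R) (distrC (since_arrival _)%:num)
  (distrC (in_service _)%:num). Qed.

Let rho_triangle Y X Z : rho X Z <= rho X Y + rho Y Z.
Proof.
rewrite /rho addrACA lerD ?ler_distD//.
by rewrite addrACA lerD ?ler_distD.
Qed.

HB.instance Definition _ := @isMetric.Build R (state R) rho
  rhoxx rho_positivity rho_sym rho_triangle.

(** The Borel sigma-algebra. *)
HB.instance Definition _ :=
  Measurable.copy (state R) (g_sigma_algebraType (@open (state R))).

(** X^+ *)
Definition arrival X : state R :=
  triple (customers X).+1 0%:nng (in_service X).

(** X^-, meaningful only when [0 < customers X]. *)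
Definition departure X : state R :=
  triple (customers X).-1 (since_arrival X) 0%:nng.

(** Deterministic motion during a time [h] without jumps. *)
Definition flow (h : {nonneg R}) X : state R :=
  triple (customers X) ((since_arrival X)%:num + h%:num)%:nng
         ((in_service X)%:num + h%:num)%:nng.

(** Difference quotient at [x] of a function on [0, +oo). The absolute value
    only serves to form an element of [{nonneg R}]: the quotient is used under
    [increments x], where [0 <= x + h]. *)
Definition diffq (phi : {nonneg R} -> R) (x : {nonneg R}) (h : R) : R :=
  h^-1 * (phi `|x%:num + h|%:nng - phi x).

(** [h] tends to 0 with [h != 0] and [0 <= x + h]: two-sided at [0 < x] and
    one-sided at the boundary point [x = 0]. *)
Definition increments (x : {nonneg R}) : set_system R :=
  within [set h | 0 <= x%:num + h] 0^'.

Section derivatives.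
Variable g : state R -> R.

Definition slice_x X : {nonneg R} -> R :=
  fun x => g (triple (customers X) x (in_service X)).
Definition slice_y X : {nonneg R} -> R :=
  fun y => g (triple (customers X) (since_arrival X) y).

Definition derivable_x X : Prop :=
  cvg (diffq (slice_x X) (since_arrival X) @ increments (since_arrival X)).
Definition derivable_y X : Prop :=
  cvg (diffq (slice_y X) (in_service X) @ increments (in_service X)).

Definition partial_x X : R :=
  lim (diffq (slice_x X) (since_arrival X) @ increments (since_arrival X)).
(** This vanishes when [customers X = 0], as [slice_y X] is then constant. *)
Definition partial_y X : R :=
  lim (diffq (slice_y X) (in_service X) @ increments (in_service X)).
End derivatives.

Definition bounded_continuous (f : state R -> R) : Prop :=
  continuous f /\ exists C : R, forall X, `|f X| <= C.

Definition test_function (g : state R -> R) : Prop :=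
  [/\ bounded_continuous g,
      forall X, derivable_x g X,
      forall X, (0 < customers X)%N -> derivable_y g X,
      bounded_continuous (partial_x g)
    & bounded_continuous (partial_y g)].

End state_space.

Section intensities.
Context {R : realType}.
Implicit Types (lam : R -> state R -> state R -> R).

(** Lambda[t, X, mu] *)
Definition intensity lam (t : R) (X : state R) (mu : probability (state R) R)
  : R := \int[mu]_Y lam t X Y.

(** L[t, X', mu] g (X) *)
Definition generator lamp lamm (t : R) (X' : state R)
    (mu : probability (state R) R) (g : state R -> R) (X : state R) : R :=
  intensity lamp t X' mu * (g (arrival X) - g X)
  + (0 < customers X)%N%:R *
      (intensity lamm t X' mu * (g (departure X) - g X))
  + partial_x g X + (0 < customers X)%N%:R * partial_y g X.

(** Borel measurability, nonnegativity and boundedness for times [0 <= t];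
    values at [t < 0] are irrelevant. *)
Definition admissible lam : Prop :=
  [/\ measurable_fun [set p : R * state R * state R | 0 <= p.1.1]
        (fun p => lam p.1.1 p.1.2 p.2),
      forall (t : R) X Y, 0 <= t -> 0 <= lam t X Y
    & exists C : R, forall (t : R) X Y, 0 <= t -> lam t X Y <= C].
End intensities.

Section trajectories.
Context {R : realType}.

(** In this section [w : R -> state R] is considered at times [0 <= t] only. *)
Implicit Types w : R -> state R.

Definition cadlag w : Prop :=
  (forall t, 0 <= t -> w @ t^'+ --> w t) /\
  (forall t, 0 < t -> exists l : state R, w @ t^'- --> l).

Definition jump_times w : set R := [set t | 0 < t /\ ~ (w @ t^'- --> w t)].

Definition piecewise_linear w : Prop :=
  [/\ forall T, finite_set (jump_times w `&` `[0, T]),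
      forall (s : R) (h : {nonneg R}), 0 <= s ->
        jump_times w `&` `]s, s + h%:num] = set0 ->
        w (s + h%:num) = flow h (w s)
    & forall t l, jump_times w t -> w @ t^'- --> l ->
        w t = arrival l \/ (0 < customers l)%N /\ w t = departure l].

(** The sigma-algebra on [0, +oo) -> state generated by the coordinates. *)
Definition path_measurable : set (set ({nonneg R} -> state R)) :=
  <<s \bigcup_(t in [set: {nonneg R}])
        preimage_set_system setT (fun w : {nonneg R} -> state R => w t)
                            measurable >>.
End trajectories.

Section processes.
Context {R : realType} d {Omega : measurableType d}.
Variable P : probability Omega R.

(** [Z] is a version of the conditional expectation of [Y] given the
    sub-sigma-algebra [G]. *)
Definition is_cond_exp (G : set (set Omega)) (Y Z : Omega -> R) : Prop :=
  [/\ P.-integrable setT (EFin \o Y),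
      P.-integrable setT (EFin \o Z),
      forall B : set R, measurable B -> G (Z @^-1` B)
    & forall A, G A ->
        (\int[P]_(w in A) (Z w)%:E = \int[P]_(w in A) (Y w)%:E)%E].

(** Indexed by times [0 <= t]. *)
Definition martingale (F : R -> set (set Omega)) (M : R -> Omega -> R) : Prop :=
  (forall t, 0 <= t -> P.-integrable setT (EFin \o M t) /\
     forall B : set R, measurable B -> F t (M t @^-1` B)) /\
  (forall s t, 0 <= s -> s <= t -> is_cond_exp (F s) (M t) (M s)).

(** A process (X_t, t >= 0); the components with [t < 0] play no role. *)
Variable X : R -> {RV P >-> state R}.

Definition natural_filtration (t : R) : set (set Omega) :=
  <<s \bigcup_(u in `[0, t]) preimage_set_system setT (X u) measurable >>.

(** P(X_t in B | X_u, u <= s) = P(X_t in B | X_s) *)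
Definition markov_property : Prop :=
  forall s t (B : set (state R)), 0 <= s -> s <= t -> measurable B ->
  exists Z : Omega -> R,
    is_cond_exp (natural_filtration s) (fun w => \1_B (X t w)) Z /\
    is_cond_exp (preimage_set_system setT (X s) measurable)
                (fun w => \1_B (X t w)) Z.

Definition dynkin_process lamp lamm (g : state R -> R) (t : R) (w : Omega)
  : R :=
  g (X t w) - g (X 0 w)
  - \int[lebesgue_measure]_(s in `[0, t])
      generator lamp lamm s (X s w) (distribution P (X s)) g (X s w).

Definition process_with_intensities (lamp lamm : R -> state R -> state R -> R)
  : Prop :=
  [/\ forall w, cadlag (fun t => X t w),
      forall w, piecewise_linear (fun t => X t w),
      markov_property
    & forall g, test_function g ->
        martingale natural_filtration (dynkin_process lamp lamm g)].

Definition trajectory (w : Omega) : {nonneg R} -> state R :=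
  fun t => X t%:num w.

End processes.

(* Main.v *)
(** For an event [A] of the past of [s], consider the expectations of
    [h (X_t)] over [A], [t >= s]. The functions
    [1(k = n) exp (- i x) exp (- j y)] are test functions and eigenfunctions of
    the deterministic flow, so for them the martingale problem and an
    integrating factor give the mild (Duhamel) equation
      [E_A h(X_t) = E_A (S_(t-s) h)(X_s)
                    + \int_s^t E_A (J_r S_(t-r) h)(X_r) dr],
    where [S] is the flow semigroup and [J_r], a bounded operator, is the jump
    part of the generator. Both sides are linear in [h] and continuous for
    bounded pointwise convergence, and these exponentials determine the Borel
    structure, so the equation holds for all bounded measurable [h]. It is
    contracting in total variation on short time intervals, including the
    dependence of [J_r] on the law of [X_r]: with [A] the sure event this
    determines the one-dimensional distributions; the jump rates are then known,
    and letting [A] range over cylinders determines the finite-dimensional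
    ones. *)
Require Import Defs.
From mathcomp Require Import all_boot all_order all_algebra.
From mathcomp Require Import all_classical all_reals all_analysis.
From mathcomp Require Import measurable_realfun zify lra ring.
Set Implicit Arguments.
Unset Strict Implicit.
Unset Printing Implicit Defensive.
Import Order.TTheory GRing.Theory Num.Theory.
Import numFieldNormedType.Exports.
Local Open Scope classical_set_scope.
Local Open Scope ring_scope.

(** * Integrals of bounded measurable functions *)

(** The rates are only measurable, so [E_A h(X_t)] need not be differentiable in [t], and for a
    general bounded [h] the shifted function [S_(t-r) h] is not a test function. For an exponential,
    [S_(t-r) h] is a scalar multiple of [h]: all time dependence sits in a number, and the
    integrating factor can be applied to an integral equation by exchanging two integrals, with no
    product rule. The resulting equation contains no derivative of [h], which is what lets it pass
    to bounded pointwise limits.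

    The two processes live on different probability spaces, so they are compared only through
    expectations of common functions [h] with values in [-1, 1], over a pair of past events [A1],
    [A2]. If [K] bounds both rates, a discrepancy [D] enters the mild equation at speed at most
    [8 K D]: [4 K D] because the restricted laws differ and [4 K D] because the intensities,
    computed from the unrestricted laws, differ. On a window of length [1 / (16 K)] the discrepancy
    is therefore halved, and since [K] does not depend on time, equal windows cover the
    half-line. *)

Section bounded_measurable.
Context {R : realType}.

(** Both conditions are global rather than relative to a domain: the class is then stable under
    algebra, composition and sections, and integrable on every measurable set of finite measure. *)
Definition bmf d (T : measurableType d) (f : T -> R) : Prop :=
  measurable_fun setT f /\ exists K, forall x, `|f x| <= K.

Context d (T : measurableType d).
Implicit Types f g : T -> R.

Lemma bmf_cst (c : R) : bmf (fun _ : T => c).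
Proof. by split; [exact: measurable_cst|exists `|c|]. Qed.

Lemma bmfD f g : bmf f -> bmf g -> bmf (fun x => f x + g x).
Proof.
move=> [mf [K fK]] [mg [L gL]]; split; first exact: measurable_funD.
by exists (K + L) => x; rewrite (le_trans (ler_normD _ _))// lerD.
Qed.

Lemma bmfM f g : bmf f -> bmf g -> bmf (fun x => f x * g x).
Proof.
move=> [mf [K fK]] [mg [L gL]]; split; first exact: measurable_funM.
by exists (K * L) => x; rewrite normrM ler_pM.
Qed.

Lemma bmfN f : bmf f -> bmf (fun x => - f x).
Proof.
move=> [mf [K fK]]; split; first exact: measurableT_comp.
by exists K => x; rewrite normrN.
Qed.

Lemma bmfB f g : bmf f -> bmf g -> bmf (fun x => f x - g x).
Proof. by move=> bf bg; apply: bmfD => //; exact: bmfN. Qed.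

Lemma bmfZ (c : R) f : bmf f -> bmf (fun x => c * f x).
Proof. by move=> bf; apply: bmfM => //; exact: bmf_cst. Qed.

Lemma bmf_indic (A : set T) : measurable A -> bmf (\1_A : T -> R).
Proof.
move=> mA; split; first exact: measurable_indic.
by exists 1 => x; rewrite indicE; case: (_ \in _); rewrite ?normr1// normr0.
Qed.

Lemma bmf_comp d' (T' : measurableType d') (h : T' -> R) (phi : T -> T') :
  measurable_fun setT phi -> bmf h -> bmf (fun x => h (phi x)).
Proof.
move=> mphi [mh [K hK]]; split; first exact: measurableT_comp.
by exists K => x.
Qed.

Lemma bmf_sum (I : Type) (s : seq I) (F : I -> T -> R) :
  (forall i, bmf (F i)) -> bmf (fun x => \sum_(i <- s) F i x).
Proof.
move=> bF; elim: s => [|i s ih].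
  by under eq_fun do rewrite big_nil; exact: bmf_cst.
by under eq_fun do rewrite big_cons; exact: bmfD.
Qed.

Variables (m : {measure set T -> \bar R}) (D : set T).
Hypotheses (mD : measurable D) (Dfin : (m D < +oo)%E).

Lemma bmf_integrable f : bmf f -> m.-integrable D (EFin \o f).
Proof.
move=> [mf [K fK]]; apply: measurable_bounded_integrable => //.
  exact: measurable_funS mf.
exists K; split; first exact: num_real.
by move=> M KM x _ /=; rewrite (le_trans (fK x))// ltW.
Qed.

Lemma bmf_RintD f g : bmf f -> bmf g ->
  \int[m]_(x in D) (f x + g x) = \int[m]_(x in D) f x + \int[m]_(x in D) g x.
Proof. by move=> bf bg; rewrite RintegralD//; exact: bmf_integrable. Qed.

Lemma bmf_RintB f g : bmf f -> bmf g ->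
  \int[m]_(x in D) (f x - g x) = \int[m]_(x in D) f x - \int[m]_(x in D) g x.
Proof. by move=> bf bg; rewrite RintegralB//; exact: bmf_integrable. Qed.

Lemma bmf_RintZ (c : R) f : bmf f ->
  \int[m]_(x in D) (c * f x) = c * \int[m]_(x in D) f x.
Proof. by move=> bf; rewrite RintegralZl//; exact: bmf_integrable. Qed.

Lemma bmf_le_Rint f (K : R) : bmf f -> (forall x, D x -> `|f x| <= K) ->
  `|\int[m]_(x in D) f x| <= K * fine (m D).
Proof.
move=> bf fK; apply: le_trans (le_normr_Rintegral mD (bmf_integrable bf)) _.
rewrite -Rintegral_cst//; apply: le_Rintegral => //.
- by have := integrable_norm (bmf_integrable bf).
- exact: bmf_integrable (bmf_cst _).
Qed.

Lemma bmf_cvg_Rint (f_ : nat -> T -> R) f (K : R) :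
  (forall n, measurable_fun setT (f_ n)) -> (forall n x, `|f_ n x| <= K) ->
  (forall x, f_ ^~ x @ \oo --> f x) ->
  \int[m]_(x in D) f_ n x @[n --> \oo] --> \int[m]_(x in D) f x.
Proof.
move=> mf_ fK f_f.
have mf : measurable_fun setT f by apply: (measurable_fun_cvg (h := f_)) => // x _.
have bf : bmf f.
  split => //; exists K => x.
  have nf : `|f_ n x| @[n --> \oo] --> `|f x| by apply: cvg_norm; exact: f_f.
  rewrite -(cvg_lim _ nf)//; apply: limr_le; first by apply/cvg_ex; exists `|f x|.
  by near=> n; exact: fK.
have [|||||_ _ h] := @dominated_convergence _ T R m D mD
    (fun n => EFin \o f_ n) (EFin \o f) (cst K%:E).
- by move=> n; apply/measurable_EFinP; exact: measurable_funS (mf_ n).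
- by apply/measurable_EFinP; exact: measurable_funS mf.
- by apply: aeW => x _; apply: cvg_EFin; [near=> n|exact: f_f].
- exact: bmf_integrable (bmf_cst _).
- by apply: aeW => x n _; rewrite lee_fin.
have ff : (\int[m]_(x in D) (EFin \o f) x)%E \is a fin_num.
  by apply: integrable_fin_num => //; exact: bmf_integrable.
apply: fine_cvg; rewrite fineK//.
Unshelve. all: by end_near. Qed.

End bounded_measurable.

Section fubini_bounded.
Context {R : realType} d1 d2 (T1 : measurableType d1) (T2 : measurableType d2).
Variables (m1 : {sigma_finite_measure set T1 -> \bar R})
  (m2 : {sigma_finite_measure set T2 -> \bar R}).
Variables (D1 : set T1) (D2 : set T2).
Hypotheses (mD1 : measurable D1) (mD2 : measurable D2).
Hypotheses (D1fin : (m1 D1 < +oo)%E) (D2fin : (m2 D2 < +oo)%E).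
Variable (f : T1 * T2 -> R).
Hypothesis bf : bmf f.

(** Extension by zero off the rectangle turns both iterated integrals into integrals over the whole
    spaces, and makes the integrand integrable even when [m1] and [m2] are infinite. *)
Let g : T1 * T2 -> R := f \_ (D1 `*` D2).

Let int_g : (m1 \x m2)%E.-integrable setT (EFin \o g).
Proof.
have mDD : measurable (D1 `*` D2) by exact: measurableX.
rewrite /g -restrict_EFin; apply/(integrable_mkcond _ mDD).1.
apply: bmf_integrable => //.
by rewrite /= product_measure1E// lte_mul_pinfty// ge0_fin_numE.
Qed.

Lemma bmf_section1 x : bmf (fun y => f (x, y)).
Proof.
case: bf => mf [K fK]; split; last by exists K.
exact: measurableT_comp mf (pair1_measurable _).
Qed.

Lemma bmf_section2 y : bmf (fun x => f (x, y)).
Proof.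
case: bf => mf [K fK]; split; last by exists K.
exact: measurableT_comp mf (pair2_measurable _).
Qed.

Lemma bmf_Fubini :
  \int[m1]_(x in D1) \int[m2]_(y in D2) f (x, y) =
  \int[m2]_(y in D2) \int[m1]_(x in D1) f (x, y).
Proof.
have := Fubini int_g; rewrite /Rintegral.
set a := integral _ _ _; set b := integral _ _ _ => ab.
transitivity (fine a); last first.
  rewrite ab /b; congr fine; rewrite [RHS]integral_mkcond.
  apply: eq_integral => y _; rewrite /= patchE.
  have intf : (\int[m1]_(x in D1) (f (x, y))%:E)%E \is a fin_num.
    apply: integrable_fin_num => //.
    exact: bmf_integrable (bmf_section2 y).
  case: ifPn => [|] yD.
    rewrite fineK// [RHS]integral_mkcond; apply: eq_integral => x _ /=.
    rewrite /g !patchE in_setX /= yD andbT.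
    by case: ifP.
  rewrite -[RHS](integral0 m1 setT); apply: eq_integral => x _ /=.
  by rewrite /g !patchE in_setX /= (negbTE yD) andbF.
rewrite /a; congr fine; rewrite [LHS]integral_mkcond.
apply: eq_integral => x _; rewrite /= patchE.
have intf : (\int[m2]_(y in D2) (f (x, y))%:E)%E \is a fin_num.
  apply: integrable_fin_num => //.
  exact: bmf_integrable (bmf_section1 x).
case: ifPn => [|] xD.
  rewrite fineK// [LHS]integral_mkcond; apply: eq_integral => y _ /=.
  rewrite /g !patchE in_setX /= xD /=.
  by case: ifP.
rewrite -[LHS](integral0 m2 setT); apply: eq_integral => y _ /=.
by rewrite /g !patchE in_setX /= (negbTE xD).
Qed.
End fubini_bounded.

Section partial_integral.
Context {R : realType} d1 d2 (T1 : measurableType d1) (T2 : measurableType d2).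
Variables (m2 : {sigma_finite_measure set T2 -> \bar R}) (D2 : set T2).
Hypotheses (mD2 : measurable D2) (D2fin : (m2 D2 < +oo)%E).
Variable (f : T1 * T2 -> R).
Hypothesis bf : bmf f.

Lemma bmf_partial_integral : bmf (fun x => \int[m2]_(y in D2) f (x, y)).
Proof.
case: (bf) => mf [K fK]; split; last first.
  exists (K * fine (m2 D2)) => x; apply: bmf_le_Rint => //.
  exact: bmf_section1.
(* Tonelli's measurability statement concerns nonnegative integrands: [f] is raised by its bound
   [K], and [K * fine (m2 D2)] is subtracted afterwards. *)
have bg : bmf (fun z => f z + K) by apply: bmfD => //; exact: bmf_cst.
have mSD : measurable ([set: T1] `*` D2) by exact: measurableX.
have -> : (fun x => \int[m2]_(y in D2) f (x, y)) = (fun x =>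
    fine (fubini_F m2 (EFin \o ((fun z => f z + K) \_ (setT `*` D2))) x)
    - K * fine (m2 D2)).
  apply/funext => x; rewrite -Rintegral_cst//; apply/eqP; rewrite eq_sym.
  rewrite subr_eq -bmf_RintD//; [|exact: bmf_section1|exact: bmf_cst].
  apply/eqP; rewrite /Rintegral /fubini_F; congr fine.
  rewrite [RHS]integral_mkcond; apply: eq_integral => y _ /=.
  by rewrite !patchE in_setX in_setT /=; case: ifP.
apply: measurable_funB => //; apply: measurableT_comp => //.
apply: measurable_fun_fubini_tonelli_F => /=.
  apply/measurable_EFinP.
  by apply/(measurable_restrictT _ _).1 => //; apply: measurable_funTS; case: bg.
move=> z; rewrite lee_fin patchE; case: ifP => // _.
by have := fK z; rewrite ler_norml => /andP[? _]; lra.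
Qed.
End partial_integral.

(** * The Borel structure of the state space *)

Section state_measurability.
Context {R : realType}.
Implicit Types X Y : state R.

Definition ck X : R := (customers X)%:R.
Definition cx X : R := (since_arrival X)%:num.
Definition cy X : R := (in_service X)%:num.

Lemma cx_ge0 X : 0 <= cx X. Proof. by rewrite /cx. Qed.
Lemma cy_ge0 X : 0 <= cy X. Proof. by rewrite /cy. Qed.

Lemma tripleK X : triple (customers X) (since_arrival X) (in_service X) = X.
Proof. by case: X. Qed.

Lemma state_ball X (e : R) : ball X e = [set Y | rho X Y < e].
Proof. by rewrite ballEmdist. Qed.

Lemma nbhs_state X (U : set (state R)) :
  nbhs X U <-> exists2 e : R, 0 < e & forall Y, rho X Y < e -> U Y.
Proof.
split=> [/nbhs_ballP[e e0 eU]|[e e0 eU]].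
  by exists e => // Y XY; apply: eU; rewrite state_ball.
by apply/nbhs_ballP; exists e => //; rewrite state_ball => Y /eU.
Qed.

Lemma lipschitz_state_continuous (f : state R -> R) :
  (forall X Y, `|f X - f Y| <= rho X Y) -> continuous f.
Proof.
move=> lf X; apply/(@cvgrPdist_lt _ _ _ (nbhs X) _) => e e0.
by apply/nbhs_state; exists e => // Y; apply: le_lt_trans.
Qed.

Lemma continuous_ck : continuous ck.
Proof.
apply: lipschitz_state_continuous => X Y.
by rewrite /rho -addrA lerDl addr_ge0.
Qed.

Lemma continuous_cx : continuous cx.
Proof.
apply: lipschitz_state_continuous => X Y.
by rewrite /rho addrAC lerDr addr_ge0.
Qed.

Lemma continuous_cy : continuous cy.
Proof. by apply: lipschitz_state_continuous => X Y; rewrite /rho lerDr addr_ge0. Qed.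

Lemma continuous_state_measurable (f : state R -> R) :
  continuous f -> measurable_fun setT f.
Proof.
move=> /continuousP cf; apply: (measurability _ (RGenOpens.measurableE R)) => //.
move=> _ [_ [a [b ->] <-]]; rewrite setTI.
by apply: sub_sigma_algebra; apply: cf; exact: interval_open.
Qed.

Lemma measurable_ck : measurable_fun setT ck.
Proof. by apply: continuous_state_measurable; exact: continuous_ck. Qed.
Lemma measurable_cx : measurable_fun setT cx.
Proof. by apply: continuous_state_measurable; exact: continuous_cx. Qed.
Lemma measurable_cy : measurable_fun setT cy.
Proof. by apply: continuous_state_measurable; exact: continuous_cy. Qed.

Definition box (n : nat) (a b : R) : set (state R) :=
  [set X | customers X = n /\ a < cx X /\ b < cy X].

(** A pi-system; the empty set is there because boxes with different numbers of customers are
    disjoint. The indicator of a box is a product of one factor per coordinate, the shape that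
    exponentials can approximate. *)
Definition boxes : set (set (state R)) :=
  [set B | B = set0 \/ exists n a b, B = box n a b].

Lemma boxes_setI : setI_closed boxes.
Proof.
move=> A B [->|[n [a [b ->]]]]; first by move=> _; left; rewrite set0I.
move=> [->|[m [a' [b' ->]]]]; first by left; rewrite setI0.
have [->|nm] := eqVneq n m; last first.
  left; rewrite -subset0 => X [[/= Xn _] [Xm _]].
  by rewrite -Xn -Xm eqxx in nm.
right; exists m, (Num.max a a'), (Num.max b b').
apply/seteqP; split => X /=; rewrite /box /= !gt_max.
  by move=> [[Xm [-> ->]] [_ [-> ->]]].
by move=> [-> [/andP[-> ->] /andP[-> ->]]].
Qed.

Lemma measurable_box n a b : measurable (box n a b).
Proof.
rewrite (_ : box n a b = ck @^-1` [set n%:R] `&` (cx @^-1` `]a, +oo[ `&`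
    cy @^-1` `]b, +oo[)).
  apply: measurableI; last apply: measurableI.
  - rewrite -[X in measurable X]setTI; apply: measurable_ck => //.
  - by rewrite -[X in measurable X]setTI; apply: measurable_cx.
  - by rewrite -[X in measurable X]setTI; apply: measurable_cy.
apply/seteqP; split => X /=; rewrite !in_itv /= !andbT.
  by move=> [<- [? ?]].
by move=> [/eqP]; rewrite eqr_nat => /eqP.
Qed.

(** A grid square of side [2 / m.+1], written as a difference of boxes. Starting at [i - 1] lets
    [i = 0] catch the clock value 0; overlaps between squares are harmless, since only a cover is
    needed. *)
Let cell m n i j : set (state R) :=
  box n ((i%:R - 1) / m.+1%:R) ((j%:R - 1) / m.+1%:R) `\`
  (box n (i.+1%:R / m.+1%:R) ((j%:R - 1) / m.+1%:R) `|`
   box n ((i%:R - 1) / m.+1%:R) (j.+1%:R / m.+1%:R)).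

Let cellP m n i j X : cell m n i j X <-> customers X = n /\
  (i%:R - 1) / m.+1%:R < cx X <= i.+1%:R / m.+1%:R /\
  (j%:R - 1) / m.+1%:R < cy X <= j.+1%:R / m.+1%:R.
Proof.
rewrite /cell /box /=; split.
  move=> [[Xn [-> ->]]] /not_orP[h1 h2] /=; split => //; split.
    by rewrite leNgt; apply/negP => ?; apply: h1.
  by rewrite leNgt; apply/negP => ?; apply: h2.
move=> [Xn [/andP[i1 i2] /andP[j1 j2]]]; split=> //.
by move=> [[_ [+ _]]|[_ [_ +]]]; rewrite ltNge ?i2 ?j2.
Qed.

Let cell_cover m X : exists i j, cell m (customers X) i j X.
Proof.
have grid (x : R) : 0 <= x -> exists i : nat,
    (i%:R - 1) / m.+1%:R < x <= i.+1%:R / m.+1%:R.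
  move=> x0; exists (Num.truncn (x * m.+1%:R)).
  have /andP[h1 h2] := truncn_itv (mulr_ge0 x0 (ler0n R m.+1)).
  rewrite ltr_pdivrMr// ler_pdivlMr// (ltW h2) andbT.
  by rewrite (lt_le_trans _ h1)// gtrBl.
have [i hi] := grid _ (cx_ge0 X); have [j hj] := grid _ (cy_ge0 X).
by exists i, j; apply/cellP.
Qed.

Let cell_rho m n i j X Y : cell m n i j X -> cell m n i j Y ->
  rho X Y <= 4 / m.+1%:R.
Proof.
move=> /cellP[Xn [/andP[x1 x2] /andP[y1 y2]]].
move=> /cellP[Yn [/andP[x1' x2'] /andP[y1' y2']]].
rewrite /rho Xn Yn subrr normr0 add0r.
have -> : 4 / m.+1%:R = 2 / m.+1%:R + 2 / m.+1%:R :> R.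
  by rewrite -mulrDl; congr (_ / _); lra.
have close (k : nat) (u v : R) : (k%:R - 1) / m.+1%:R < u ->
    u <= k.+1%:R / m.+1%:R -> (k%:R - 1) / m.+1%:R < v ->
    v <= k.+1%:R / m.+1%:R -> `|u - v| <= 2 / m.+1%:R.
  move=> u1 u2 v1 v2; rewrite ler_norml.
  have -> : 2 / m.+1%:R = k.+1%:R / m.+1%:R - (k%:R - 1) / m.+1%:R :> R.
    by rewrite -mulrBl -natr1; congr (_ / _); lra.
  move: u1 u2 v1 v2; move: (_ / _) (_ / _) => p q *; apply/andP; split; lra.
by apply: lerD; [exact: (close i)|exact: (close j)].
Qed.

(** An open set is the union of the countably many grid cells that it contains, because the cells of
    mesh [m] have diameter at most [4 / m.+1]. *)
Lemma measurable_stateE : @measurable _ (state R) = <<s boxes >>.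
Proof.
rewrite eqEsubset; split; last first.
  apply: smallest_sub; first exact: sigma_algebra_measurable.
  by move=> _ [->|[n [a [b ->]]]]//; exact: measurable_box.
apply: smallest_sub; first exact: smallest_sigma_algebra.
move=> U oU.
have mbox n a b : measurable (box n a b : set (g_sigma_algebraType boxes)).
  by apply: sub_sigma_algebra; right; exists n, a, b.
have mcell m n i j : measurable (cell m n i j : set (g_sigma_algebraType boxes)).
  by apply: measurableD => //; exact: measurableU.
pose F m n i j := if pselect (cell m n i j `<=` U) then cell m n i j else set0.
have -> : U = \bigcup_m \bigcup_n \bigcup_i \bigcup_j F m n i j.
  apply/seteqP; split => [X UX|X [m _ [n _ [i _ [j _]]]]]; last first.
    by rewrite /F; case: pselect => // h /h.
  have /nbhs_state[e e0 eU] : nbhs X U by exact: open_nbhs_nbhs.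
  have [m me] : exists m : nat, 4 / m.+1%:R < e.
    exists (Num.truncn (4 / e)).
    rewrite ltr_pdivrMr// mulrC -ltr_pdivrMr//.
    by have /andP[] := truncn_itv (divr_ge0 (ler0n R 4) (ltW e0)).
  have [i [j Xij]] := cell_cover m X.
  exists m => //; exists (customers X) => //; exists i => //; exists j => //.
  rewrite /F; case: pselect => // -[] Y Yij.
  by apply: eU; exact: le_lt_trans (cell_rho Xij Yij) me.
apply: (@bigcupT_measurable _ (g_sigma_algebraType boxes)) => m.
apply: (@bigcupT_measurable _ (g_sigma_algebraType boxes)) => n.
apply: (@bigcupT_measurable _ (g_sigma_algebraType boxes)) => i.
apply: (@bigcupT_measurable _ (g_sigma_algebraType boxes)) => j.
rewrite /F; case: pselect => ?; first exact: mcell.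
exact: (@measurable0 _ (g_sigma_algebraType boxes)).
Qed.

(** The preimage of a box splits into one condition on each real coordinate. This replaces product
    measurability, as [state] is not a product type. *)
Lemma measurable_fun_state d (T : measurableType d) (D : set T)
    (f : T -> state R) :
  measurable_fun D (fun t => ck (f t)) -> measurable_fun D (fun t => cx (f t)) ->
  measurable_fun D (fun t => cy (f t)) -> measurable_fun D f.
Proof.
move=> mk mx my mD; apply: (measurability _ measurable_stateE) => //.
move=> _ [_ [->|[n [a [b ->]]]] <-]; first by rewrite preimage_set0 setI0.
have -> : D `&` f @^-1` box n a b = (D `&` (fun t => ck (f t)) @^-1` [set n%:R]) `&`
    ((D `&` (fun t => cx (f t)) @^-1` `]a, +oo[) `&`
     (D `&` (fun t => cy (f t)) @^-1` `]b, +oo[)).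
  apply/seteqP; split => t /=; rewrite !in_itv /= !andbT /box /=.
    by move=> [Dt [<- [? ?]]].
  by move=> [[Dt /eqP]]; rewrite eqr_nat => /eqP -> [[_ ?] [_ ?]].
apply: measurableI; last apply: measurableI.
- by apply: mk.
- by apply: mx.
- by apply: my.
Qed.

End state_measurability.

(** * Exponential test functions *)

Section difference_quotients.
Context {R : realType}.

(** Small positive increments are admissible at every [x], the boundary included, so limits along
    [increments x] are unique. *)
Lemma increments_proper (x : {nonneg R}) : ProperFilter (increments x).
Proof.
split; last exact: within_filter.
rewrite /increments /within /= /nbhs /= => -[e /= e0] h.
have := h (e / 2); rewrite /ball /= sub0r normrN gtr0_norm ?divr_gt0//.
rewrite gtr_pMr// invf_lt1// ltr1n => /(_ isT).
by apply; [rewrite gt_eqF// divr_gt0|rewrite addr_ge0// divr_ge0// ltW].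
Qed.

Lemma cvg_diffq (phi : {nonneg R} -> R) (F : R -> R) (x : {nonneg R}) (l : R) :
  (forall z : {nonneg R}, phi z = F z%:num) -> is_derive x%:num 1 F l ->
  diffq phi x @ increments x --> l.
Proof.
move=> phiF [dF <-].
have dF' : h^-1 * (F (h + x%:num) - F x%:num) @[h --> 0^'] --> 'D_1 F x%:num.
  rewrite (_ : (fun h => _) =
      (fun h => h^-1 *: ((F \o shift x%:num) (h *: 1) - F x%:num))); first exact: dF.
  by apply/funext => h; rewrite /= [_ *: 1]mulr1.
have FF : Filter (increments x) by exact: within_filter.
apply: cvg_trans (cvg_within_filter _ dF').
apply: near_eq_cvg.
rewrite /increments near_withinE; apply: nearW => h xh.
by rewrite /diffq !phiF /= (ger0_norm xh) [h + _]addrC.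
Qed.

Lemma is_derive_cexpR (c a x : R) :
  is_derive x 1 (fun z => c * expR (- (a * z))) (- a * (c * expR (- (a * x)))).
Proof.
have da : is_derive x 1 (fun z : R => - (a * z)) (- a).
  by apply: is_derive_eq; rewrite [_ *: 1]mulr1.
have := is_derive1_comp (is_derive_expR _) da.
by move=> /(is_deriveZ c) /is_derive_eq; apply; rewrite /GRing.scale /=; ring.
Qed.
End difference_quotients.

Section test_functions.
Context {R : realType}.
Implicit Types X : state R.

Variables n i j : nat.

Definition tf X : R :=
  (customers X == n)%:R * expR (- (i%:R * cx X)) * expR (- (j%:R * cy X)).

(** Decay rate of [tf] along the flow. The service clock runs only when there are customers, so [j]
    counts only for [0 < n]. *)
Definition tf_rate : nat := (i + j * (0 < n))%N.

Lemma tf_ge0 X : 0 <= tf X.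
Proof. by rewrite /tf !mulr_ge0// ?expR_ge0. Qed.

Lemma tf_le1 X : tf X <= 1.
Proof.
have e1 (k : nat) (z : R) : 0 <= z -> expR (- (k%:R * z)) <= 1.
  by move=> z0; rewrite -expR0 ler_expR oppr_le0 mulr_ge0.
rewrite /tf !mulr_ile1 ?mulr_ge0 ?expR_ge0 ?e1 ?cx_ge0 ?cy_ge0//.
by case: (customers X == n).
Qed.

Lemma continuous_tf : continuous tf.
Proof.
move=> X; pose F : set_system (state R) := nbhs X.
have FF : Filter F by exact: nbhs_filter.
have ce (k : nat) (f : state R -> R) : continuous f ->
    expR (- (k%:R * f Y)) @[Y --> F] --> expR (- (k%:R * f X)).
  move=> cf; apply: (cvg_comp (fun Y => - (k%:R * f Y)) expR _ (@continuous_expR R _)).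
  by apply: cvgN; apply: cvgM; [exact: cvg_cst|exact: cf].
have cn : (customers Y == n)%:R @[Y --> F] --> ((customers X == n)%:R : R).
  apply: cvg_near_cst.
  (* Distinct numbers of customers are at distance at least 1, so the unit ball stays in one
     level. *)
  apply/nbhs_state; exists 1 => // Y XY; congr (_ == _)%:R.
  have : `|ck X - ck Y| < 1 by apply: le_lt_trans XY; rewrite /rho -addrA lerDl addr_ge0.
  rewrite /ck; case: (ltngtP (customers X) (customers Y)) => [XltY|YltX|->//].
    by rewrite distrC -natrB 1?ltnW// normr_nat ltrn1 => /eqP; lia.
  by rewrite -natrB 1?ltnW// normr_nat ltrn1 => /eqP; lia.
apply: cvgM; first apply: cvgM => //.
- exact: ce continuous_cx.
- exact: ce continuous_cy.
Qed.

(** An idle state has service clock 0, so the factor [0 < customers X] can be inserted for free. It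
    makes the formulas correct for [triple 0 x y], where [y] is discarded. *)
Lemma busy_cy X : (j * (0 < customers X))%:R * cy X = j%:R * cy X.
Proof. by case: X => [x|k x y]; rewrite /cy /= ?muln1// !mulr0. Qed.

Lemma tf_triple k (x y : {nonneg R}) : tf (triple k x y) =
  (k == n)%:R * expR (- (i%:R * x%:num)) * expR (- ((j * (0 < k))%:R * y%:num)).
Proof.
rewrite /tf /cx /cy; case: k => [|k] /=; last by rewrite muln1.
by rewrite mulr0 muln0 mul0r.
Qed.

Lemma cvg_diffq_tf_x X :
  diffq (slice_x tf X) (since_arrival X) @ increments (since_arrival X) -->
  - i%:R * tf X.
Proof.
pose c := (customers X == n)%:R * expR (- (j%:R * cy X)) : R.
rewrite (_ : tf X = c * expR (- (i%:R * (since_arrival X)%:num))); last first.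
  by rewrite /tf /c mulrAC.
apply: (cvg_diffq (F := fun z => c * expR (- (i%:R * z)))).
  move=> z; rewrite /slice_x tf_triple /c mulrAC; congr (_ * expR (- _) * _).
  exact: busy_cy.
exact: is_derive_cexpR.
Qed.

Lemma cvg_diffq_tf_y X :
  diffq (slice_y tf X) (in_service X) @ increments (in_service X) -->
  - (j * (0 < customers X))%:R * tf X.
Proof.
pose c := (customers X == n)%:R * expR (- (i%:R * cx X)) : R.
pose b := (j * (0 < customers X))%:R : R.
rewrite -/b (_ : tf X = c * expR (- (b * (in_service X)%:num))); last first.
  by rewrite -{1}(tripleK X) tf_triple.
apply: (cvg_diffq (F := fun z => c * expR (- (b * z)))).
  by move=> z; rewrite /slice_y tf_triple.
exact: is_derive_cexpR.
Qed.

Lemma partial_x_tf X : partial_x tf X = - i%:R * tf X.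
Proof.
have := increments_proper (since_arrival X) => ?.
by apply: cvg_lim => //; exact: cvg_diffq_tf_x.
Qed.

Lemma partial_y_tf X : partial_y tf X = - (j * (0 < n))%:R * tf X.
Proof.
have := increments_proper (in_service X) => ?.
apply: cvg_lim => //; suff <- : - (j * (0 < customers X))%:R * tf X =
    - (j * (0 < n))%:R * tf X by exact: cvg_diffq_tf_y.
by rewrite /tf; have [->//|_] := eqVneq (customers X) n; rewrite !mul0r !mulr0.
Qed.

Lemma bounded_continuous_Ztf (c : R) : bounded_continuous (fun X => c * tf X).
Proof.
split.
  move=> X; pose F : set_system (state R) := nbhs X.
  have FF : Filter F by exact: nbhs_filter.
  by apply: (@cvgM _ _ F FF); [exact: cvg_cst|exact: continuous_tf].
exists `|c| => X; rewrite normrM ler_piMr// ger0_norm ?tf_le1 ?tf_ge0//.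
Qed.

Lemma test_function_tf : test_function tf.
Proof.
split.
- have := bounded_continuous_Ztf 1; congr bounded_continuous.
  by apply/funext => X; rewrite mul1r.
- by move=> X; apply/cvg_ex; eexists; exact: cvg_diffq_tf_x.
- by move=> X _; apply/cvg_ex; eexists; exact: cvg_diffq_tf_y.
- have -> : partial_x tf = (fun X => - i%:R * tf X).
    by apply/funext => X; exact: partial_x_tf.
  exact: bounded_continuous_Ztf.
- have -> : partial_y tf = (fun X => - (j * (0 < n))%:R * tf X).
    by apply/funext => X; exact: partial_y_tf.
  exact: bounded_continuous_Ztf.
Qed.

(** The eigenfunction property that ties the integrating factor to the deterministic flow. *)
Lemma tf_flow h X : tf (flow h X) = expR (- (tf_rate%:R * h%:num)) * tf X.
Proof.
rewrite -{2}(tripleK X) /flow !tf_triple /=.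
rewrite /tf_rate; have [->|_] := eqVneq (customers X) n; last by rewrite !(mul0r, mulr0).
rewrite !mul1r natrD -!expRD; congr expR; ring.
Qed.

Lemma bmf_tf : bmf tf.
Proof.
split; first exact: continuous_state_measurable continuous_tf.
by exists 1 => X; rewrite ger0_norm ?tf_le1 ?tf_ge0.
Qed.

End test_functions.

(** * Exponentials determine bounded measurable functions *)

Section indicator_approximation.
Context {R : realType}.

(** With [q] the square root of [r], the sequence is [m q^m] times [q^m]. The first factor is
    bounded by [1 / (1 - q)], since [m q^m] is at most the geometric sum of [q^k] for [k < m]; the
    second tends to 0. *)
Lemma cvg_natr_expr (r : R) : 0 <= r -> r < 1 -> m%:R * r ^+ m @[m --> \oo] --> 0.
Proof.
move=> r0 r1; pose q := Num.sqrt r.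
have q0 : 0 <= q by exact: sqrtr_ge0.
have q1 : q < 1 by rewrite -sqrtr1 ltr_sqrt.
have rE : r = q * q by rewrite -expr2 sqr_sqrtr.
have qm1 m : q ^+ m <= 1 by rewrite exprn_ile1// ltW.
have mq m : m%:R * q ^+ m * (1 - q) <= 1 - q ^+ m.
  elim: m => [|m ih]; first by rewrite expr0 !mul0r subrr.
  have -> : m.+1%:R * q ^+ m.+1 * (1 - q) =
      q * (m%:R * q ^+ m * (1 - q)) + q ^+ m.+1 * (1 - q).
    by rewrite exprS -natr1; ring.
  apply: le_trans (_ : q * (1 - q ^+ m) + q ^+ m.+1 * (1 - q) <= _).
    by rewrite lerD2r ler_wpM2l.
  rewrite exprS -subr_ge0; have -> : 1 - q * q ^+ m -
    (q * (1 - q ^+ m) + q * q ^+ m * (1 - q)) = (1 - q) * (1 - q * q ^+ m) by ring.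
  by rewrite -exprS mulr_ge0// subr_ge0// ltW.
have qcvg : (1 - q)^-1 * q ^+ m @[m --> \oo] --> (1 - q)^-1 * 0.
  by apply: cvgM; [exact: cvg_cst|apply: cvg_expr; rewrite ger0_norm].
rewrite mulr0 in qcvg.
apply: squeeze_cvgr (cvg_cst (0 : R)) qcvg; apply: nearW => m.
rewrite mulr_ge0 ?exprn_ge0//= rE exprMn mulrA ler_wpM2r ?exprn_ge0//.
rewrite -[leRHS]div1r ler_pdivlMr ?subr_gt0//.
by rewrite (le_trans (mq m))// gerBl exprn_ge0.
Qed.

Lemma bernoulli_ge (v : R) k : 0 <= v -> v <= 1 -> 1 - k%:R * v <= (1 - v) ^+ k.
Proof.
move=> v0 v1; elim: k => [|k ih]; first by rewrite mul0r subr0 expr0.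
rewrite exprS; apply: le_trans (_ : (1 - v) * (1 - k%:R * v) <= _).
  rewrite -subr_ge0 -natr1; have -> : (1 - v) * (1 - k%:R * v) -
    (1 - (k%:R + 1) * v) = k%:R * (v * v) by ring.
  by rewrite !mulr_ge0.
by rewrite ler_wpM2l// subr_ge0.
Qed.

(** Upper counterpart of Bernoulli's inequality: [(1 - v)^k] is small once [k v] is large. The
    induction uses [(1 - v)(1 + (k + 1) v) <= 1 + k v]. *)
Lemma bernoulli_le (v : R) k : 0 <= v -> v <= 1 -> (1 - v) ^+ k * (1 + k%:R * v) <= 1.
Proof.
move=> v0 v1; elim: k => [|k ih]; first by rewrite mul0r addr0 expr0 mulr1.
rewrite exprSr -mulrA; apply: le_trans ih.
rewrite ler_wpM2l ?exprn_ge0 ?subr_ge0// -subr_ge0 -natr1.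
have -> : 1 + k%:R * v - (1 - v) * (1 + (k%:R + 1) * v) = (k%:R + 1) * (v * v).
  by ring.
by rewrite !mulr_ge0// addr_ge0.
Qed.

(* With [u = e^-x] and [c = e^-a], the polynomials [(1 - u^m)^N] separate
   [u < c] from [c <= u] as soon as [N c^m] tends to infinity slowly. *)
Let N (c : R) (m : nat) : nat := (Num.truncn (m%:R * c ^- m)).+1.

(** A negative threshold is passed by every clock value, hence the constant 1; in the other branch
    [expR (- a) <= 1]. *)
Definition indic_poly (a : R) (m : nat) : {poly R} :=
  if a < 0 then 1 else (1 - 'X^m) ^+ (N (expR (- a)) m).

Lemma indic_poly01 a m (x : R) : 0 <= x -> 0 <= (indic_poly a m).[expR (- x)] <= 1.
Proof.
move=> x0; rewrite /indic_poly; case: ifP => _; first by rewrite hornerC ler01 lexx.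
rewrite !hornerE; set u := expR _.
have u0 : 0 <= u ^+ m by rewrite exprn_ge0// expR_ge0.
have u1 : u ^+ m <= 1.
  by rewrite exprn_ile1 ?expR_ge0// -expR0 ler_expR oppr_le0.
by rewrite exprn_ge0 ?exprn_ile1//; lra.
Qed.

(** [N] is about [m c^-m], so [N u^m] equals [m (u/c)^m] up to an error [u^m]. For [u < c] it tends
    to 0 and Bernoulli gives the limit 1. For [c <= u] it is at least [m], so the power is at most
    [1 / (1 + m)]; the extra factor [m] in [N] settles the boundary case [u = c], that is [x = a],
    where the limit must be 0. *)
Lemma cvg_indic_poly a (x : R) : 0 <= x ->
  (indic_poly a m).[expR (- x)] @[m --> \oo] --> ((a < x)%R%:R : R).
Proof.
move=> x0; rewrite /indic_poly; have [a0|a0] := ltP a 0.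
  have -> : a < x by exact: lt_le_trans x0.
  by under eq_fun do rewrite hornerC; exact: cvg_cst.
under eq_fun do rewrite !hornerE.
set u := expR (- x); set c := expR (- a).
have c0 : 0 < c by exact: expR_gt0.
have u0 : 0 < u by exact: expR_gt0.
have c1 : c <= 1 by rewrite -expR0 ler_expR oppr_le0.
have u1 : u <= 1 by rewrite -expR0 ler_expR oppr_le0.
have um1 m : u ^+ m <= 1 by rewrite exprn_ile1// ltW.
have um0 m : 0 <= u ^+ m by rewrite exprn_ge0// ltW.
have p01 m : 0 <= (1 - u ^+ m) ^+ N c m <= 1.
  by have v0 := um0 m; have v1 := um1 m; rewrite exprn_ge0 ?exprn_ile1//; lra.
have NE m : m%:R * (u / c) ^+ m <= (N c m)%:R * u ^+ m <=
    m%:R * (u / c) ^+ m + u ^+ m.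
  have -> : m%:R * (u / c) ^+ m = m%:R * c ^- m * u ^+ m.
    by rewrite exprMn exprVn; ring.
  have cm0 : 0 <= c ^- m by rewrite invr_ge0 exprn_ge0// ltW.
  have /andP[t1 t2] := truncn_itv (mulr_ge0 (ler0n R m) cm0).
  have -> : m%:R * c ^- m * u ^+ m + u ^+ m = (m%:R * c ^- m + 1) * u ^+ m by ring.
  by rewrite !ler_wpM2r ?(ltW t2)// /N -natr1 lerD2r.
have [ax|xa] := ltP a x.
  have uc : u / c < 1 by rewrite ltr_pdivrMr// mul1r ltr_expR ltrN2.
  have uc0 : 0 <= u / c by rewrite divr_ge0// ltW.
  have ult1 : u < 1 by rewrite -expR0 ltr_expR oppr_lt0 (le_lt_trans a0).
  have lo : 1 - (m%:R * (u / c) ^+ m + u ^+ m) @[m --> \oo] --> (1 - (0 + 0) : R).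
    apply: cvgB; first exact: cvg_cst.
    by apply: cvgD; [exact: cvg_natr_expr|apply: cvg_expr; rewrite gtr0_norm].
  rewrite addr0 subr0 in lo.
  apply: squeeze_cvgr lo (cvg_cst (1 : R)); apply: nearW => m.
  have /andP[_ ->] := p01 m; rewrite andbT.
  apply: le_trans (bernoulli_ge _ (um0 m) (um1 m)).
  by rewrite lerD2l lerN2; have /andP[] := NE m.
have uc : 1 <= u / c by rewrite ler_pdivlMr// mul1r ler_expR lerN2.
apply: squeeze_cvgr (cvg_cst (0 : R)) (@cvg_harmonic R); apply: nearW => m.
have /andP[-> _] := p01 m; rewrite /=.
have mN : m%:R <= (N c m)%:R * u ^+ m.
  have /andP[+ _] := NE m; apply: le_trans.
  by rewrite ler_peMr// exprn_ege1.
rewrite -[leRHS]div1r ler_pdivlMr// (_ : m.+1%:R = 1 + m%:R); last first.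
  by rewrite -natr1 addrC.
apply: le_trans (bernoulli_le (N c m) (um0 m) (um1 m)).
rewrite ler_wpM2l//; first by have /andP[] := p01 m.
by rewrite lerD2l.
Qed.

End indicator_approximation.

(** * Linear functionals continuous for bounded pointwise convergence *)

Section normal_functionals.
Context {R : realType} d (S : measurableType d).

(** On bounded measurable functions this is integration against a finite signed measure, in a form
    that needs no measure to be constructed. *)
Record normal_functional (T : (S -> R) -> R) : Prop := NormalFunctional {
  normalD : forall f g, bmf f -> bmf g -> T (fun X => f X + g X) = T f + T g;
  normalZ : forall c f, bmf f -> T (fun X => c * f X) = c * T f;
  normal_cvg : forall (f_ : nat -> S -> R) f K,
    (forall n, measurable_fun setT (f_ n)) -> (forall n X, `|f_ n X| <= K) ->
    (forall X, f_ ^~ X @ \oo --> f X) -> T (f_ n) @[n --> \oo] --> T f }.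

Variables (T : (S -> R) -> R) (nT : normal_functional T).

Lemma normal_sum0 (I : Type) (s : seq I) (F : I -> S -> R) :
  (forall i, bmf (F i)) -> (forall i, T (F i) = 0) ->
  T (fun X => \sum_(i <- s) F i X) = 0.
Proof.
move=> bF F0; elim: s => [|i s ih].
  under eq_fun do rewrite big_nil -[0](mul0r 0).
  by rewrite (normalZ nT) ?mul0r//; exact: bmf_cst.
under eq_fun do rewrite big_cons.
by rewrite (normalD nT)// ?F0 ?ih ?addr0//; exact: bmf_sum.
Qed.

Lemma normal_cvg0 (f_ : nat -> S -> R) f K :
  (forall n, bmf (f_ n)) -> (forall n X, `|f_ n X| <= K) ->
  (forall X, f_ ^~ X @ \oo --> f X) -> (forall n, T (f_ n) = 0) -> T f = 0.
Proof.
move=> bf fK f_f T0.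
have := normal_cvg nT (fun n => (bf n).1) fK f_f.
under eq_fun do rewrite T0.
by move=> /cvg_unique; apply => //; exact: cvg_cst.
Qed.

Lemma disjoint_sum_indic (F : nat -> set S) n X : trivIset setT F ->
  \sum_(k < n) (\1_(F k) X : R) = (`[< exists2 k, (k < n)%N & F k X >])%:R.
Proof.
move=> tF; have [[k kn FkX]|nF] := pselect (exists2 k, (k < n)%N & F k X).
  rewrite asboolT; last by exists k.
  rewrite (bigD1 (Ordinal kn))//= indicE mem_set// big1 ?addr0// => i /eqP ik.
  rewrite indicE memNset// => FiX; apply: ik; apply: ord_inj => /=.
  have /trivIsetP/(_ i k I I) := tF.
  have [//|_ /(_ isT)] := eqVneq (i : nat) k.
  by rewrite -subset0 => /(_ X); case.
rewrite asboolF// big1// => i _; rewrite indicE memNset// => FiX.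
by apply: nF; exists i.
Qed.

(** Countable additivity: the partial sums of the indicators are bounded by 1 and converge
    pointwise. *)
Lemma normal_bigcup0 (F : nat -> set S) : trivIset setT F ->
  (forall n, measurable (F n)) -> (forall n, T \1_(F n) = 0) ->
  T \1_(\bigcup_n F n) = 0.
Proof.
move=> tF mF F0.
have bF n : bmf (\1_(F n) : S -> R) by exact: bmf_indic.
apply: (normal_cvg0 (f_ := fun n X => \sum_(k < n) \1_(F k) X) (K := 1)).
- by move=> n; exact: bmf_sum.
- move=> n X; rewrite disjoint_sum_indic//.
  by case: asbool; rewrite ?normr1// normr0.
- move=> X; under eq_fun do rewrite disjoint_sum_indic//.
  apply: cvg_near_cst; rewrite indicE.
  have [[k _ FkX]|nF] := pselect ((\bigcup_n F n) X).
    exists k.+1 => // n /= kn; rewrite asboolT; last by exists k.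
    by rewrite mem_set//; exists k.
  apply: nearW => n; rewrite asboolF ?memNset// => -[k _ FkX].
  by apply: nF; exists k.
- by move=> n; exact: normal_sum0.
Qed.

(** For [0 <= x] this is the minimum of [n] and the integer part of [x], hence within 1 of [x] as
    long as [x <= n]. *)
Let count (x : R) n : R := \sum_(k < n) ((k.+1%:R <= x)%R%:R : R).

Let countP x n : 0 <= x ->
  [/\ count x n <= x, count x n <= n%:R & count x n = n%:R \/ x - 1 < count x n].
Proof.
move=> x0; rewrite /count; elim: n => [|n [ih1 ih2 ih3]].
  by rewrite big_ord0; split=> //; left.
rewrite big_ord_recr /=; set c := \sum_(i < n) _ in ih1 ih2 ih3 *.
have [nx|xn] := lerP n.+1%:R x.
  have cn : c = n%:R by case: ih3 => // cx; move: nx; rewrite -natr1 => nx; lra.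
  by rewrite cn /= natr1; split => //; left.
rewrite addr0; split => //; first by rewrite (le_trans ih2)// ler_nat.
by right; move: xn; rewrite -natr1; case: ih3 => [->|] ?; lra.
Qed.

(* A bounded function is the limit of averages of the indicators of its
   superlevel sets. *)
Lemma normal_indic_eq0 : (forall A, measurable A -> T \1_A = 0) ->
  forall h, bmf h -> T h = 0.
Proof.
move=> T0 h [mh [K hK]].
pose L := `|K| + 1; have L0 : 0 < L by rewrite ltr_pwDr.
have hL X : - L <= h X <= L.
  rewrite -ler_norml (le_trans (hK X))// /L.
  by rewrite (le_trans (ler_norm K))// lerDl.
(* Affine normalisation to values in [0, 1], undone by [hE]; the [+ 1] in [L] keeps the denominator
   positive even for [K = 0]. *)
pose g X := (h X + L) / (2 * L).
have g0 X : 0 <= g X by have /andP[? _] := hL X; rewrite divr_ge0//; lra.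
have g1 X : g X <= 1.
  by have /andP[_ ?] := hL X; rewrite ler_pdivrMr ?mulr_gt0//; lra.
have mg : measurable_fun setT g by apply: measurable_funM => //; apply: measurable_funD.
have bg : bmf g by split => //; exists 1 => X; rewrite ger0_norm.
have hE : h = (fun X => 2 * L * g X + - L * \1_setT X).
  apply/funext => X; rewrite indicT mulr1 /g mulrC divfK ?addrK//.
  by rewrite mulf_neq0// gt_eqF.
have Tg : T g = 0.
  pose A n k : set S := [set X | k.+1%:R <= n.+1%:R * g X].
  have mA n k : measurable (A n k).
    rewrite (_ : A n k = (fun X => n.+1%:R * g X) @^-1` `[k.+1%:R, +oo[%classic).
      by rewrite -[X in measurable X]setTI; apply: measurable_funM.
    by apply/seteqP; split => X /=; rewrite in_itv/= andbT.
  have AE n k X : \1_(A n k) X = (k.+1%:R <= n.+1%:R * g X)%R%:R :> R.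
    rewrite indicE; have [kg|kg] := boolP (k.+1%:R <= n.+1%:R * g X).
      by rewrite mem_set.
    by rewrite memNset// => /= gk; rewrite gk in kg.
  apply: (normal_cvg0 (K := 1)
    (f_ := fun n X => n.+1%:R^-1 * \sum_(k < n.+1) \1_(A n k) X)).
  - by move=> n; apply: bmfZ; apply: bmf_sum => k; exact: bmf_indic.
  - move=> n X; under eq_bigr do rewrite AE.
    have [_ cn _] := @countP (n.+1%:R * g X) n.+1 (mulr_ge0 (ler0n _ _) (g0 X)).
    rewrite ger0_norm; last by rewrite mulr_ge0// sumr_ge0.
    by rewrite ler_pdivrMl// mulr1.
  - move=> X; apply/cvgrPdist_le => e e0; near=> n.
    under eq_bigr do rewrite AE.
    have [c1 c2 c3] := @countP (n.+1%:R * g X) n.+1 (mulr_ge0 (ler0n _ _) (g0 X)).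
    rewrite -/(count _ _).
    rewrite -[X in `|X - _|](mulKf (_ : n.+1%:R != 0))// -mulrBr normrM.
    rewrite ger0_norm// ler_pdivrMl//; apply: (@le_trans _ _ 1).
      have ng : n.+1%:R * g X <= n.+1%:R by rewrite ler_piMr.
      rewrite ler_norml; apply/andP; split; first by lra.
      by case: c3 => c3; lra.
    rewrite -ler_pdivrMr// (@le_trans _ _ n%:R) ?ler_nat//.
    by near: n; exact: nbhs_infty_ger.
  - move=> n; rewrite (normalZ nT).
      by rewrite normal_sum0 ?mulr0// => [k|k]; [exact: bmf_indic|exact: T0].
    by apply: bmf_sum => k; exact: bmf_indic.
rewrite hE (normalD nT); [|exact: bmfZ|by apply: bmfZ; exact: bmf_indic].
rewrite (normalZ nT)// (normalZ nT); last exact: bmf_indic.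
by rewrite Tg T0// !mulr0 addr0.
Unshelve. all: by end_near. Qed.

(** [G] need not contain the whole space. The partition [g] into members of [G] supplies
    [T \1_setT = 0], from which complements follow in the Dynkin induction. *)
Lemma normal_dynkin (G : set (set S)) (g : nat -> set S) :
  @measurable _ S = <<s G >> -> setI_closed G ->
  (forall n, G (g n)) -> trivIset setT g -> \bigcup_n g n = setT ->
  (forall A, G A -> T \1_A = 0) -> forall h, bmf h -> T h = 0.
Proof.
move=> GE GI Gg tg gT G0; apply: normal_indic_eq0.
have mG A : G A -> measurable A by rewrite GE; exact: sub_sigma_algebra.
have T0 : T \1_setT = 0.
  by rewrite -gT; apply: normal_bigcup0 => // n; [exact: mG|exact: G0].
rewrite GE; apply: dynkin_induction => //.
- move=> A mA TA.
  rewrite (_ : \1_(~` A) = (fun X => \1_setT X + -1 * \1_A X)); last first.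
    apply/funext => X; rewrite mulN1r !indicE in_setT in_setC.
    by case: (X \in A); rewrite /= ?subrr ?subr0.
  rewrite (normalD nT) ?(normalZ nT) ?T0 ?TA ?mulr0 ?addr0//; try exact: bmf_indic.
  by apply: bmfZ; exact: bmf_indic.
- by move=> F mF tF F0; exact: normal_bigcup0.
Qed.

End normal_functionals.

Section exponential_determining.
Context {R : realType}.
Variables (T : (state R -> R) -> R) (nT : normal_functional T).
Hypothesis Ttf : forall n i j, T (tf n i j) = 0.

(** Polynomials in [exp (- x)] and [exp (- y)] on one level: expanding them gives finite
    combinations of the functions [tf n i j]. *)
Let pf n (p q : {poly R}) (X : state R) : R :=
  (customers X == n)%:R * p.[expR (- cx X)] * q.[expR (- cy X)].

Let pfE n p q : pf n p q = (fun X =>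
  \sum_(i < size p) \sum_(j < size q) p`_i * q`_j * tf n i j X).
Proof.
apply/funext => X; rewrite /pf !horner_coef -mulrA big_distrlr /= mulr_sumr.
apply: eq_bigr => i _; rewrite mulr_sumr; apply: eq_bigr => j _.
by rewrite /tf -!mulrN !expRM_natl; ring.
Qed.

Let bmf_Ztf n i j (c : R) : bmf (fun X => c * tf n i j X).
Proof. by apply: bmfZ; exact: bmf_tf. Qed.

Let Tpf n p q : bmf (pf n p q) /\ T (pf n p q) = 0.
Proof.
rewrite pfE; split; first by apply: bmf_sum => i; exact: bmf_sum.
apply: (normal_sum0 nT) => i; first exact: bmf_sum.
apply: (normal_sum0 nT) => // j.
by rewrite (normalZ nT) ?Ttf ?mulr0//; exact: bmf_tf.
Qed.

Lemma normal_tf_eq0 h : bmf h -> T h = 0.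
Proof.
(* Clock values exceed -1, so these boxes are the full levels and partition the space. *)
apply: (@normal_dynkin _ _ _ _ nT boxes (fun n => box n (-1) (-1))).
- exact: measurable_stateE.
- exact: boxes_setI.
- by move=> n; right; exists n, (-1), (-1).
- apply/trivIsetP => i j _ _ ij; rewrite -subset0 => X [[Xi _] [Xj _]].
  by rewrite -Xi -Xj eqxx in ij.
- apply/seteqP; split => // X _; exists (customers X) => //; split => //.
  by have := cx_ge0 X; have := cy_ge0 X; split; lra.
move=> _ [->|[n [a [b ->]]]].
  rewrite (_ : \1_set0 = fun X => 0 * 0).
    by rewrite (normalZ nT) ?mul0r//; exact: bmf_cst.
  by apply/funext => X; rewrite indic0 mul0r.
apply: (normal_cvg0 nT (f_ := fun m => pf n (indic_poly a m) (indic_poly b m)) (K := 1)).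
- by move=> m; case: (Tpf n (indic_poly a m) (indic_poly b m)).
- move=> m X; rewrite /pf !normrM.
  have /andP[p0 p1] := indic_poly01 a m (cx_ge0 X).
  have /andP[q0 q1] := indic_poly01 b m (cy_ge0 X).
  by rewrite !mulr_ile1 ?mulr_ge0// ?ger0_norm//; case: (customers X == n).
- move=> X.
  rewrite (_ : \1_(box n a b) X =
      (customers X == n)%:R * (a < cx X)%R%:R * (b < cy X)%R%:R).
    apply: cvgM; [apply: cvgM; [exact: cvg_cst|]|].
      exact: cvg_indic_poly (cx_ge0 X).
    exact: cvg_indic_poly (cy_ge0 X).
  rewrite indicE; have [bX|nX] := pselect (box n a b X).
    by rewrite mem_set//; have [-> [-> ->]] := bX; rewrite eqxx !mulr1.
  rewrite memNset//; have [Xn|] := eqVneq; last by rewrite !mul0r.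
  have [ax|] := ltP a; last by rewrite mulr0 mul0r.
  by have [bx|] := ltP b; [case: nX|rewrite mulr0].
- by move=> m; case: (Tpf n (indic_poly a m) (indic_poly b m)).
Qed.
End exponential_determining.

(** * Bounded kernels in functional form *)

Section normal_operators.
Context {R : realType} d (S : measurableType d).

(** A bounded signed kernel from [Z] to [S]. The constant [C] depends on [K] alone, uniformly in [h]
    and [z]; it provides the dominating function when [z] is integrated out. *)
Record normal_op d' (Z : measurableType d') (Op : (S -> R) -> Z -> R) : Prop :=
  NormalOp {
    normal_op_bmf : forall h, bmf h -> bmf (Op h);
    normal_op_bound : forall K, exists C, forall h,
      bmf h -> (forall X, `|h X| <= K) -> forall z, `|Op h z| <= C;
    normal_op_at : forall z, normal_functional (Op ^~ z) }.

Lemma normal_op_eval d' (Z : measurableType d') (kappa : Z -> R) (phi : Z -> S) :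
  bmf kappa -> measurable_fun setT phi ->
  normal_op (fun h z => kappa z * h (phi z)).
Proof.
move=> bk mphi; split.
- by move=> h bh; apply: bmfM => //; exact: bmf_comp.
- have [_ [L kL]] := bk => K; exists (L * K) => h _ hK z.
  by rewrite normrM ler_pM.
- move=> z; split.
  + by move=> f g _ _; rewrite mulrDr.
  + by move=> c f _; rewrite mulrCA.
  + by move=> f_ f K _ _ f_f; apply: cvgM; [exact: cvg_cst|exact: f_f].
Qed.

Lemma normal_functionalD (T1 T2 : (S -> R) -> R) :
  normal_functional T1 -> normal_functional T2 ->
  normal_functional (fun h => T1 h + T2 h).
Proof.
move=> n1 n2; split.
- by move=> f g bf bg; rewrite (normalD n1)// (normalD n2)// addrACA.
- by move=> c f bf; rewrite (normalZ n1)// (normalZ n2)// mulrDr.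
- move=> f_ f K mf fK f_f.
  by apply: cvgD; [exact: (normal_cvg n1 mf fK f_f)|exact: (normal_cvg n2 mf fK f_f)].
Qed.

Lemma normal_functionalN (T : (S -> R) -> R) :
  normal_functional T -> normal_functional (fun h => - T h).
Proof.
move=> n; split.
- by move=> f g bf bg; rewrite (normalD n)// opprD.
- by move=> c f bf; rewrite (normalZ n)// mulrN.
- by move=> f_ f K mf fK f_f; apply: cvgN; exact: (normal_cvg n mf fK f_f).
Qed.

Lemma normal_opD d' (Z : measurableType d') (Op1 Op2 : (S -> R) -> Z -> R) :
  normal_op Op1 -> normal_op Op2 -> normal_op (fun h z => Op1 h z + Op2 h z).
Proof.
move=> n1 n2; split.
- by move=> h bh; apply: bmfD; [exact: (normal_op_bmf n1 bh)|exact: (normal_op_bmf n2 bh)].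
- move=> K; have [C1 h1] := normal_op_bound n1 K; have [C2 h2] := normal_op_bound n2 K.
  exists (C1 + C2) => h bh hK z; rewrite (le_trans (ler_normD _ _))// lerD//.
    exact: h1.
  exact: h2.
- move=> z; apply: normal_functionalD; first exact: normal_op_at n1 z.
  exact: normal_op_at n2 z.
Qed.

Lemma normal_opN d' (Z : measurableType d') (Op : (S -> R) -> Z -> R) :
  normal_op Op -> normal_op (fun h z => - Op h z).
Proof.
move=> n; split.
- by move=> h bh; apply: bmfN; exact: (normal_op_bmf n bh).
- move=> K; have [C hC] := normal_op_bound n K.
  by exists C => h bh hK z; rewrite normrN; exact: hC.
- by move=> z; apply: normal_functionalN; exact: normal_op_at n z.
Qed.

Lemma normal_functional_int d' (Z : measurableType d') (Op : (S -> R) -> Z -> R)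
    (m : {measure set Z -> \bar R}) (D : set Z) :
  measurable D -> (m D < +oo)%E -> normal_op Op ->
  normal_functional (fun h => \int[m]_(z in D) Op h z).
Proof.
move=> mD mDoo n; have bO h : bmf h -> bmf (Op h) by exact: (normal_op_bmf n).
split.
- move=> f g bf bg; rewrite -(bmf_RintD mD mDoo (bO _ bf) (bO _ bg)).
  by apply: eq_Rintegral => z _; rewrite (normalD (normal_op_at n z)).
- move=> c f bf; rewrite -(bmf_RintZ mD mDoo _ (bO _ bf)).
  by apply: eq_Rintegral => z _; rewrite (normalZ (normal_op_at n z)).
- move=> f_ f K mf fK f_f; have [C hC] := normal_op_bound n K.
  have bf k : bmf (f_ k) by split => //; exists K.
  apply: (bmf_cvg_Rint mD mDoo (K := C)).
  + by move=> k; case: (normal_op_bmf n (bf k)).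
  + by move=> k z; exact: hC.
  + by move=> z; exact: (normal_cvg (normal_op_at n z) mf fK f_f).
Qed.

Lemma normal_op_int d1 d2 (Z1 : measurableType d1) (Z2 : measurableType d2)
    (Op : (S -> R) -> Z1 * Z2 -> R)
    (m : {sigma_finite_measure set Z2 -> \bar R}) (D : set Z2) :
  measurable D -> (m D < +oo)%E -> normal_op Op ->
  normal_op (fun h x => \int[m]_(y in D) Op h (x, y)).
Proof.
move=> mD mDoo n; split.
- by move=> h bh; apply: bmf_partial_integral => //; exact: (normal_op_bmf n bh).
- move=> K; have [C hC] := normal_op_bound n K; exists (C * fine (m D)) => h bh hK x.
  apply: bmf_le_Rint => //; first by apply: bmf_section1; exact: (normal_op_bmf n bh).
  by move=> y _; exact: hC.
- move=> x; apply: (normal_functional_int (Op := fun h y => Op h (x, y))) => //.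
  split.
  + by move=> h bh; apply: bmf_section1; exact: (normal_op_bmf n bh).
  + move=> K; have [C hC] := normal_op_bound n K.
    by exists C => h bh hK y; exact: hC.
  + by move=> y; exact: normal_op_at n (x, y).
Qed.

End normal_operators.

Lemma bmf_bool {R : realType} d (T : measurableType d) (p : pred T) :
  measurable [set x | p x] -> bmf (fun x => (p x)%:R : R).
Proof.
move=> mp; rewrite (_ : (fun x => _) = \1_[set x | p x]); first exact: bmf_indic.
apply/funext => x; rewrite indicE; case: (boolP (p x)) => px.
  by rewrite mem_set.
by rewrite memNset// => /= px'; rewrite px' in px.
Qed.

(** * Variation of constants for integral equations *)

Section integrating_factor.
Context {R : realType}.
Notation leb := (@lebesgue_measure R).

Lemma leb_itvcc_fin (s t : R) : (leb `[s, t] < +oo)%E.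
Proof.
rewrite lebesgue_measure_itv /=.
by case: ifP => // _; rewrite ltry.
Qed.

(** Used for [r <= t], where it is [exp (- g (t - r))]; the absolute value keeps it bounded by 1 on
    the whole line when [0 <= g]. *)
Definition discount (g t r : R) : R := expR (- (g * `|t - r|)).

Lemma bmf_discount g t : 0 <= g -> bmf (discount g t).
Proof.
move=> g0; split.
  apply: measurableT_comp => //; apply: measurableT_comp => //.
  apply: measurable_funM => //; apply: measurableT_comp => //.
  exact: measurable_funB.
exists 1 => r; rewrite ger0_norm ?expR_ge0// -expR0 ler_expR oppr_le0.
by rewrite mulr_ge0.
Qed.

Lemma Rintegral_discount (g q t : R) : q <= t ->
  \int[leb]_(r in `[q, t]) (g * discount g t r) = 1 - discount g t q.
Proof.
move=> qt; pose F r := expR (- (g * (t - r))).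
have FE : F = (fun r => expR (- (g * t)) * expR (- (- g * r))).
  by apply/funext => r; rewrite -expRD; congr expR; ring.
have dF (r : R) : is_derive r 1 F (g * F r).
  by have := is_derive_cexpR (expR (- (g * t))) (- g) r; rewrite FE opprK.
transitivity (\int[leb]_(r in `[q, t]) (g * F r)).
  apply: eq_Rintegral => r; rewrite inE /= in_itv /= => /andP[_ rt].
  by rewrite /discount ger0_norm// subr_ge0.
have -> : discount g t q = F q by rewrite /discount ger0_norm// subr_ge0.
have -> : 1 = F t by rewrite /F subrr mulr0 oppr0 expR0.
(* The fundamental theorem of calculus is applied on a nondegenerate interval; a single point is
   treated apart. *)
move: qt; rewrite le_eqVlt => /predU1P[->|qt].
  by rewrite set_itv1 Rintegral_set1 subrr.
have cF : continuous F.
  by move=> r; apply: differentiable_continuous; apply/derivable1_diffP; case: (dF r).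
rewrite /Rintegral (continuous_FTC2 (F := F) qt)//.
- apply: continuous_subspaceT => r; apply: cvgM; [exact: cvg_cst|exact: cF].
- split.
  + by move=> r _; case: (dF r).
  + by apply: cvg_at_right_filter; exact: cF.
  + by apply: cvg_at_left_filter; exact: cF.
- by move=> r _; rewrite derive1E; have [_ ->] := dF r.
Qed.

Lemma bmf_leR (r : R) : bmf (fun q : R => (q <= r)%R%:R : R).
Proof.
by apply: bmf_bool; rewrite (_ : mkset _ = `]-oo, r]%classic).
Qed.

Lemma bmf_geR (r : R) : bmf (fun q : R => (r <= q)%R%:R : R).
Proof.
apply: bmf_bool; rewrite (_ : mkset _ = `[r, +oo[%classic)//.
by apply/seteqP; split => x /=; rewrite in_itv/= andbT.
Qed.

(** As [psi] is only measurable, [phi] cannot be differentiated. Instead the integral equation at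
    time [r] is multiplied by [g * discount g t r] and integrated over [r]; exchanging the order of
    integration does the work of integration by parts. *)
Lemma integrating_factor (g s t : R) (phi psi : R -> R) : 0 <= g -> s <= t ->
  bmf phi -> bmf psi ->
  (forall r, s <= r -> r <= t ->
     phi r = phi s + \int[leb]_(q in `[s, r]) (psi q - g * phi q)) ->
  phi t = discount g t s * phi s
    + \int[leb]_(r in `[s, t]) (discount g t r * psi r).
Proof.
move=> g0 st bphi bpsi phiE.
pose f q := psi q - g * phi q.
have bf : bmf f by apply: bmfB => //; exact: bmfZ.
pose e := discount g t.
have be : bmf e by exact: bmf_discount.
have mst : measurable (`[s, t] : set R) by [].
have lst := leb_itvcc_fin s t.
have bZe : bmf (fun r => g * e r) by exact: bmfZ.
(* The integrand lives on the triangle [s <= q <= r <= t]. Integrating [q] first gives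
   [g e(r) (phi r - phi s)] by the equation; integrating [r] first gives [f q (1 - e q)]. *)
pose k (z : R * R) := g * e z.1 * f z.2 * (z.2 <= z.1)%R%:R.
have bk : bmf k.
  apply: bmfM; first apply: bmfM.
  - exact: (bmf_comp (h := fun r => g * e r) measurable_fst).
  - exact: (bmf_comp (h := f) measurable_snd).
  - apply: (bmf_bool (p := fun z : R * R => z.2 <= z.1)).
    rewrite (_ : mkset _ = (fun z : R * R => z.1 - z.2) @^-1` `[0, +oo[%classic).
      by rewrite -[X in measurable X]setTI; apply: measurable_funB.
    by apply/seteqP; split => z /=; rewrite in_itv/= andbT subr_ge0.
have cut (D : set R) (h : R -> R) (p : pred R) :
    \int[leb]_(x in D) (h x * (p x)%:R) = \int[leb]_(x in D `&` [set x | p x]) h x.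
  rewrite Rintegral_mkcondr; apply: eq_Rintegral => x _; rewrite patchE.
  case: (boolP (p x)) => px; first by rewrite mem_set// mulr1.
  by rewrite memNset ?mulr0// => /= px'; rewrite px' in px.
have := bmf_Fubini (m1 := leb) (m2 := leb) mst mst lst lst bk.
have inner r : r \in `[s, t] -> \int[leb]_(q in `[s, t]) k (r, q) =
    g * e r * phi r - g * e r * phi s.
  rewrite in_itv /= => /andP[sr rt].
  under eq_Rintegral do rewrite /k /= -mulrA.
  rewrite (bmf_RintZ (m := leb) mst lst (g * e r)
    (f := fun q => f q * (q <= r)%R%:R)); last first.
    apply: bmfM => //; exact: bmf_leR.
  rewrite cut (_ : _ `&` _ = `[s, r]%classic); last first.
    apply/seteqP; split => q /=; rewrite !in_itv /=; first by move=> [/andP[-> _]].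
    by move=> /andP[-> qr]; rewrite qr (le_trans qr rt).
  by rewrite (phiE r sr rt) -/f; ring.
have outer q : q \in `[s, t] -> \int[leb]_(r in `[s, t]) k (r, q) =
    f q - f q * e q.
  rewrite in_itv /= => /andP[sq qt].
  under eq_Rintegral do rewrite /k /= [_ * f q]mulrC -mulrA.
  rewrite (bmf_RintZ (m := leb) mst lst (f q)
    (f := fun r => g * e r * (q <= r)%R%:R)); last first.
    apply: bmfM => //; exact: bmf_geR.
  rewrite cut (_ : _ `&` _ = `[q, t]%classic); last first.
    apply/seteqP; split => r /=; rewrite !in_itv /=; first by move=> [/andP[_ ->] ->].
    by move=> /andP[qr ->]; rewrite qr (le_trans sq qr).
  by rewrite Rintegral_discount//; rewrite -/e; ring.
rewrite [LHS](_ : _ =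
    \int[leb]_(r in `[s, t]) (g * (e r * phi r) - phi s * (g * e r))); last first.
  by apply: eq_Rintegral => r /[!inE] /inner ->; ring.
rewrite [RHS](_ : _ =
    \int[leb]_(q in `[s, t]) (f q - (e q * psi q - g * (e q * phi q)))); last first.
  by apply: eq_Rintegral => q /[!inE] /outer ->; rewrite /f; ring.
have bephi : bmf (fun r => e r * phi r) by exact: bmfM.
have bepsi : bmf (fun r => e r * psi r) by exact: bmfM.
rewrite (bmf_RintB (m := leb) mst lst (bmfZ g bephi) (bmfZ (phi s) bZe)).
rewrite (bmf_RintB (m := leb) mst lst bf (bmfB bepsi (bmfZ g bephi))).
rewrite (bmf_RintB (m := leb) mst lst bepsi (bmfZ g bephi)).
rewrite !(bmf_RintZ (m := leb) mst lst _ bephi) (bmf_RintZ (m := leb) mst lst _ bZe).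
rewrite Rintegral_discount//.
(* The integral of [e * phi] appears on both sides and cancels; the integral of [f] is
   [phi t - phi s]. *)
have := phiE t st (lexx t); rewrite -/f -/(e _); lra.
Qed.
End integrating_factor.

(** * Measurability in time and intensities *)

Section joint_measurability.
Context {R : realType} d (Omega : measurableType d) (P : probability Omega R).
Variable X : R -> {RV P >-> state R}.
Hypothesis cX : forall w, cadlag (fun t => X t w).

Let grid (n : nat) (r : R) : nat := Num.truncn (`|r| * n.+1%:R).

Let grid_set n k : measurable [set r : R | grid n r = k].
Proof.
rewrite (_ : mkset _ = (fun r : R => `|r| * n.+1%:R) @^-1` `[k%:R, k.+1%:R[%classic).
  by rewrite -[X in measurable X]setTI; apply: measurable_funM.
apply/seteqP; split => r /=; rewrite in_itv /= -truncn_eq ?mulr_ge0// => /eqP//.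
Qed.

(** The least multiple of [1 / n.+1] strictly above [|r|]. Strictness matters because the right
    limit at [|r|] excludes the point itself. *)
Let approx n (r : R) : R := (grid n r).+1%:R / n.+1%:R.

Let approx_gt n r : `|r| < approx n r.
Proof.
rewrite /approx ltr_pdivlMr//.
by have /andP[] := truncn_itv (mulr_ge0 (normr_ge0 r) (ler0n R n.+1)).
Qed.

Let approx_cvg r : approx n r @[n --> \oo] --> `|r|.
Proof.
have up : `|r| + n.+1%:R^-1 @[n --> \oo] --> `|r| + 0.
  by apply: cvgD; [exact: cvg_cst|exact: cvg_harmonic].
rewrite addr0 in up; apply: squeeze_cvgr (cvg_cst `|r|) up.
apply: nearW => n; rewrite (ltW (approx_gt _ _))/= /approx.
rewrite -natr1 mulrDl mul1r lerD2r ler_pdivrMr//.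
by have /andP[] := truncn_itv (mulr_ge0 (normr_ge0 r) (ler0n R n.+1)).
Qed.

(** With time rounded up to the grid the process uses countably many times, so preimages are
    countable unions of rectangles; right-continuity carries joint measurability to the limit. *)
Let joint_component (f : state R -> R) : continuous f ->
  measurable_fun setT (fun z : R * Omega => f (X `|z.1| z.2)).
Proof.
move=> cf; apply: (measurable_fun_cvg (h := fun n z => f (X (approx n z.1) z.2))).
  move=> n _ B mB; rewrite setTI.
  rewrite (_ : _ @^-1` B = \bigcup_k ([set r : R | grid n r = k] `*`
      (fun w => f (X (k.+1%:R / n.+1%:R) w)) @^-1` B)).
    apply: bigcupT_measurable => k; apply: measurableX => //.
    rewrite -[X in measurable X]setTI.
    have := measurableT_comp (continuous_state_measurable cf)
      (measurable_funPT (X (k.+1%:R / n.+1%:R))).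
    by apply.
  apply/seteqP; split => [z Bz|z [k _ [/= zk]]].
    by exists (grid n z.1).
  by rewrite /approx zk.
move=> z _ /=.
have [rc _] := cX z.2.
have := rc `|z.1| (normr_ge0 _) => rz.
have : f (X t z.2) @[t --> `|z.1|^'+] --> f (X `|z.1| z.2).
  exact: (cvg_comp _ f rz (cf _)).
move=> /cvg_at_rightP; apply; split; [by move=> n; exact: approx_gt|exact: approx_cvg].
Qed.

(* Only times [0 <= t] matter: [`|t|] is a total substitute for [t]. *)
Lemma joint_measurable : measurable_fun setT (fun z : R * Omega => X `|z.1| z.2).
Proof.
apply: measurable_fun_state; apply: joint_component.
- exact: continuous_ck.
- exact: continuous_cx.
- exact: continuous_cy.
Qed.

End joint_measurability.

Section state_maps.
Context {R : realType}.
Implicit Types X : state R.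

Definition busy X : R := (0 < customers X)%N%:R.

Lemma bmf_busy : bmf busy.
Proof.
apply: bmf_bool; rewrite (_ : mkset _ = ck @^-1` `]0, +oo[%classic).
  by rewrite -[X in measurable X]setTI; apply: measurable_ck.
by apply/seteqP; split => X /=; rewrite in_itv/= andbT /ck ltr0n.
Qed.

Lemma measurable_arrival : measurable_fun setT (@arrival R).
Proof.
apply: measurable_fun_state.
- rewrite (_ : (fun _ => _) = (fun X => ck X + 1)).
    by apply: measurable_funD => //; exact: measurable_ck.
  by apply/funext => X; rewrite natr1.
- by rewrite (_ : (fun _ => _) = (fun=> 0)).
- exact: measurable_cy.
Qed.

Lemma measurable_departure : measurable_fun setT (@departure R).
Proof.
apply: measurable_fun_state.
(* The natural predecessor stops at 0, which subtracting [busy] reproduces. *)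
- rewrite (_ : (fun _ => _) = (fun X => ck X - busy X)).
    by apply: measurable_funB; [exact: measurable_ck|case: bmf_busy].
  apply/funext => -[x|[|j] x y] /=; rewrite /ck /busy /= ?subr0 ?subrr//.
  by rewrite -natr1 -[j.+2%:R]natr1 addrK natr1.
- rewrite (_ : (fun _ => _) = cx); first exact: measurable_cx.
  by apply/funext => -[x|[|j] x y].
- rewrite (_ : (fun _ => _) = (fun=> 0)) //.
  by apply/funext => -[x|[|j] x y].
Qed.

Definition shift_state (r : R) X : state R := flow `|r|%:nng X.

Lemma measurable_shift :
  measurable_fun setT (fun z : R * state R => shift_state z.1 z.2).
Proof.
have mn : measurable_fun setT (fun z : R * state R => `|z.1|).
  exact: measurableT_comp.
apply: measurable_fun_state.
- rewrite (_ : (fun _ => _) = (fun z => ck z.2)).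
    exact: measurableT_comp measurable_ck measurable_snd.
  by apply/funext => -[r [x|j x y]].
- rewrite (_ : (fun _ => _) = (fun z => cx z.2 + `|z.1|)).
    by apply: measurable_funD => //; exact: measurableT_comp measurable_cx measurable_snd.
  by apply/funext => -[r [x|j x y]].
- rewrite (_ : (fun _ => _) = (fun z => busy z.2 * (cy z.2 + `|z.1|))).
    apply: measurable_funM; last apply: measurable_funD => //.
      exact: measurableT_comp bmf_busy.1 measurable_snd.
    exact: measurableT_comp measurable_cy measurable_snd.
  by apply/funext => -[r [x|j x y]]; rewrite /busy/= ?mul0r// mul1r.
Qed.

End state_maps.

Section intensities.
Context {R : realType} d (Omega : measurableType d) (P : probability Omega R).
Variable X : R -> {RV P >-> state R}.
Hypothesis cX : forall w, cadlag (fun t => X t w).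
Variables (lam : R -> state R -> state R -> R) (lam_adm : admissible lam).

(* Intensities are only constrained at nonnegative times. *)
Definition lam0 (z : R * state R * state R) : R :=
  ((fun p => lam p.1.1 p.1.2 p.2) \_ [set p : R * state R * state R | 0 <= p.1.1]) z.

Lemma bmf_lam0 : bmf lam0.
Proof.
have [ml l0 [C lC]] := lam_adm; split.
  apply/(measurable_restrictT _ _).1 => //.
  rewrite (_ : mkset _ = (fun p : R * state R * state R => p.1.1) @^-1` `[0, +oo[%classic).
    rewrite -[X in measurable X]setTI.
    exact: (measurableT_comp measurable_fst measurable_fst).
  by apply/seteqP; split => z /=; rewrite in_itv/= andbT.
exists `|C| => -[[t x] y]; rewrite /lam0 patchE; case: ifPn => [|_]; last by rewrite normr0.
rewrite inE /= => t0; rewrite ger0_norm ?l0//.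
by rewrite (le_trans (lC _ _ _ t0))// ler_norm.
Qed.

(** The intensity at the law of the process, written as an expectation over [Omega], so that joint
    measurability in time and state is a case of partial integration. *)
Definition Lam (z : R * state R) : R := \int[P]_w lam0 (z, X `|z.1| w).

Lemma bmf_Lam : bmf Lam.
Proof.
have Poo : (P setT < +oo)%E by rewrite probability_setT ltry.
apply: (@bmf_partial_integral R _ _ _ _ P setT measurableT Poo
  (fun u : (R * state R) * Omega => lam0 (u.1, X `|u.1.1| u.2))).
apply: bmf_comp bmf_lam0; apply/measurable_fun_pair => //.
have mp : measurable_fun setT (fun u : (R * state R) * Omega => (u.1.1, u.2)).
  by apply/measurable_fun_pair => //; exact: (measurableT_comp measurable_fst).
exact: measurableT_comp (joint_measurable cX) mp.
Qed.

Lemma intensityE t x : 0 <= t -> intensity lam t x (distribution P (X t)) = Lam (t, x).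
Proof.
move=> t0; rewrite /intensity /Lam /Rintegral; congr fine.
have lE y : lam t x y = lam0 (t, x, y) by rewrite /lam0 patchE mem_set.
under eq_integral do rewrite lE.
have b : bmf (fun y => lam0 (t, x, y)) := bmf_section1 bmf_lam0 (t, x).
rewrite integral_distribution /=.
- by rewrite ger0_norm.
- by apply/measurable_EFinP; case: b.
- have Poo : (P setT < +oo)%E by rewrite probability_setT ltry.
  exact: (bmf_integrable measurableT Poo (bmf_comp (measurable_funPT (X t)) b)).
Qed.

Lemma Lam_bound (K : R) : (forall u, `|lam0 u| <= K) -> forall z, `|Lam z| <= K.
Proof.
move=> lK z; have Poo : (P setT < +oo)%E by rewrite probability_setT ltry.
have <- : K * fine (P setT) = K by rewrite probability_setT mulr1.
apply: bmf_le_Rint => //.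
exact: (bmf_comp (measurable_funPT (X `|z.1|)) (bmf_section1 bmf_lam0 z)).
Qed.

End intensities.

(** * The mild equation *)

Section jump_operator.
Context {R : realType}.

(** The rates are arguments because linearity is used twice: in [h] for the passage to limits, and
    in [(a, b)] to compare the intensities of two processes. *)
Definition jump_op (a b : R * state R -> R) (h : state R -> R) (z : R * state R) : R :=
  a z * (h (arrival z.2) - h z.2) + busy z.2 * (b z * (h (departure z.2) - h z.2)).

Definition jump_shift d (Omega : measurableType d) (a b : R * state R -> R)
    (Y : R * Omega -> state R) (t : R) (h : state R -> R) (z : R * Omega) : R :=
  jump_op a b (fun x => h (shift_state (t - z.1) x)) (z.1, Y z).

(** The operator is a sum of four terms, each a bounded weight times the value of [h] at a
    measurably transformed state. *)
Lemma normal_jump_shift d (Omega : measurableType d) (a b : R * state R -> R)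
    (Y : R * Omega -> state R) (t : R) :
  bmf a -> bmf b -> measurable_fun setT Y -> normal_op (jump_shift a b Y t).
Proof.
move=> ba bb mY.
have mp : measurable_fun setT (fun z : R * Omega => (z.1, Y z)).
  by apply/measurable_fun_pair.
pose aY z := a (z.1, Y z); pose bY z := busy (Y z) * b (z.1, Y z).
have baY : bmf aY by exact: bmf_comp mp ba.
have bbY : bmf bY.
  by apply: bmfM; [exact: bmf_comp mY bmf_busy|exact: bmf_comp mp bb].
have mshift (F : state R -> state R) : measurable_fun setT F ->
    measurable_fun setT (fun z : R * Omega => shift_state (t - z.1) (F (Y z))).
  move=> mF; have mq : measurable_fun setT (fun z : R * Omega => (t - z.1, F (Y z))).
    apply/measurable_fun_pair; first by apply: measurable_funB.
    exact: measurableT_comp mF mY.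
  exact: measurableT_comp measurable_shift mq.
pose ev (k : R * Omega -> R) (F : state R -> state R) (h : state R -> R) z :=
  k z * h (shift_state (t - z.1) (F (Y z))).
have nev k F : bmf k -> measurable_fun setT F -> normal_op (ev k F).
  by move=> bk mF; apply: normal_op_eval => //; exact: mshift.
have -> : jump_shift a b Y t = (fun h z =>
    ev aY (@arrival R) h z + - ev aY idfun h z
    + (ev bY (@departure R) h z + - ev bY idfun h z)).
  apply/funext => h; apply/funext => z.
  by rewrite /jump_shift /jump_op /ev /aY /bY /=; ring.
have mid : measurable_fun setT (@idfun (state R)) by exact: measurable_id.
apply: normal_opD; apply: normal_opD; try apply: normal_opN; apply: nev => //.
- exact: measurable_arrival.
- exact: measurable_departure.
Qed.

Lemma bmf_jump_op a b h : bmf a -> bmf b -> bmf h -> bmf (jump_op a b h).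
Proof.
move=> ba bb bh; have b2 k : bmf k -> bmf (fun z : R * state R => k z.2 : R).
  exact: bmf_comp measurable_snd.
apply: bmfD; [|apply: bmfM; [exact: b2 bmf_busy|]]; apply: bmfM => //;
  apply: bmfB; try exact: b2.
- exact: b2 (bmf_comp measurable_arrival bh).
- exact: b2 (bmf_comp measurable_departure bh).
Qed.

Lemma jump_opZ a b (c : R) h z :
  jump_op a b (fun x => c * h x) z = c * jump_op a b h z.
Proof. by rewrite /jump_op; ring. Qed.

End jump_operator.

Section mild_formula.
Context {R : realType} d (Omega : measurableType d) (P : probability Omega R).
Variable X : R -> {RV P >-> state R}.
Variables (lamp lamm : R -> state R -> state R -> R).
Hypotheses (lamp_adm : admissible lamp) (lamm_adm : admissible lamm).
Hypothesis process : process_with_intensities X lamp lamm.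
Notation leb := (@lebesgue_measure R).

Let cX w : cadlag (fun t => X t w). Proof. by case: process. Qed.

Let a := Lam X lamp.
Let b := Lam X lamm.
Let ba : bmf a. Proof. exact: bmf_Lam. Qed.
Let bb : bmf b. Proof. exact: bmf_Lam. Qed.
Let Y (z : R * Omega) := X `|z.1| z.2.
Let mY : measurable_fun setT Y. Proof. exact: joint_measurable. Qed.

Lemma natural_filtration_measurable s A : natural_filtration X s A -> measurable A.
Proof.
apply: smallest_sub; first exact: sigma_algebra_measurable.
by move=> B [u _ [C mC <-]]; exact: (measurable_funPT (X u)).
Qed.

Section test.
Variables n i j : nat.
Let h : state R -> R := tf n i j.
Let g : R := (tf_rate n i j)%:R.

(** The generator applied to [h] along the path: for an eigenfunction the derivative terms collapse
    to [- g * h]. *)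
Let G (z : R * Omega) : R := jump_op a b h (z.1, Y z) - g * h (Y z).

Let generatorE q w : 0 <= q ->
  generator lamp lamm q (X q w) (distribution P (X q)) h (X q w) = G (q, w).
Proof.
move=> q0; rewrite /generator !intensityE// /G /Y /= ger0_norm// /jump_op /=.
rewrite partial_x_tf partial_y_tf -/a -/b -/h /g /tf_rate natrD natrM.
(* The indicator before the [y]-derivative changes nothing: off level [n] the function [h] vanishes,
   and for [n = 0] the coefficient does. *)
suff -> : busy (X q w) * (- (j%:R * (0 < n)%N%:R) * h (X q w)) =
    - (j%:R * (0 < n)%N%:R) * h (X q w) by rewrite /busy; ring.
rewrite /busy /h /tf; have [->|_] := eqVneq (customers (X q w)) n.
  by case: (0 < n)%N; rewrite ?mulr0 ?mul1r// !mul0r oppr0 !mul0r.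
by rewrite !mul0r !mulr0.
Qed.

Let bjump : bmf (fun z : R * Omega => jump_op a b h (z.1, Y z)).
Proof.
have mp : measurable_fun setT (fun z : R * Omega => (z.1, Y z)).
  by apply/measurable_fun_pair.
exact: bmf_comp mp (bmf_jump_op ba bb (bmf_tf _ _ _)).
Qed.

Let bhY : bmf (fun z => h (Y z)).
Proof. exact: bmf_comp mY (bmf_tf _ _ _). Qed.

Let bG : bmf G.
Proof. exact: bmfB bjump (bmfZ g bhY). Qed.

Variables (s : R) (A : set Omega).
Hypotheses (s0 : 0 <= s) (FA : natural_filtration X s A).
Let mA : measurable A. Proof. exact: natural_filtration_measurable FA. Qed.
Let Aoo : (P A < +oo)%E.
Proof. by rewrite (le_lt_trans (probability_le1 _ mA))// ltry. Qed.

Let phi (r : R) : R := \int[P]_(w in A) h (X `|r| w).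
Let psi (r : R) : R := \int[P]_(w in A) jump_op a b h (r, X `|r| w).

Let bphi : bmf phi.
Proof. exact: (bmf_partial_integral mA Aoo (f := fun z => h (Y z))). Qed.

Let bpsi : bmf psi.
Proof. exact: (bmf_partial_integral mA Aoo (f := fun z => jump_op a b h (z.1, Y z))). Qed.

Let dynkinE t w : 0 <= t -> dynkin_process X lamp lamm h t w =
  h (X t w) - h (X 0 w) - \int[leb]_(q in `[0, t]) G (q, w).
Proof.
move=> t0; rewrite /dynkin_process; congr (_ - _).
apply: eq_Rintegral => q; rewrite inE /= in_itv /= => /andP[q0 _].
exact: generatorE.
Qed.

Let bdynkin t : 0 <= t -> bmf (dynkin_process X lamp lamm h t).
Proof.
move=> t0; rewrite (_ : dynkin_process X lamp lamm h t = (fun w =>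
  h (X t w) - h (X 0 w) - \int[leb]_(q in `[0, t]) G (q, w))); last first.
  by apply/funext => w; exact: dynkinE.
have bX u : bmf (fun w => h (X u w)) := bmf_comp (measurable_funPT (X u)) (bmf_tf _ _ _).
apply: bmfB; first exact: bmfB.
apply: (bmf_partial_integral (m2 := leb) _ _
    (f := fun z : Omega * R => G (z.2, z.1))) => //.
  exact: leb_itvcc_fin.
by apply: bmf_comp bG; apply/measurable_fun_pair.
Qed.

(** The martingale property tested on the past event [A] equates the expectations of the Dynkin
    process at [s] and [t]; Fubini moves [E_A] inside the time integral. *)
Let phi_eq t : s <= t -> phi t = phi s + \int[leb]_(q in `[s, t]) (psi q - g * phi q).
Proof.
move=> st; have t0 : 0 <= t by exact: le_trans st.
have [_ _ _ mart] := process.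
have [_ /(_ s t s0 st)[_ _ _ /(_ A FA)]] := mart h (test_function_tf _ _ _).
move=> Mst.
have {Mst} : \int[P]_(w in A) dynkin_process X lamp lamm h s w =
    \int[P]_(w in A) dynkin_process X lamp lamm h t w by rewrite /Rintegral Mst.
move=> /eqP; rewrite -subr_eq0 -(bmf_RintB mA Aoo (bdynkin s0) (bdynkin t0)).
have splitG w : \int[leb]_(q in `[0, t]) G (q, w) =
    \int[leb]_(q in `[0, s]) G (q, w) + \int[leb]_(q in `[s, t]) G (q, w).
  have iG (u v : R) : leb.-integrable `[u, v] (EFin \o (fun q => G (q, w))).
    apply: bmf_integrable => //; first exact: leb_itvcc_fin.
    exact: bmf_section2.
  rewrite -(Rintegral_itv_obnd_cbnd (r := s)); last first.
    by apply: integrableS (iG s t) => //; exact: subset_itv_oc_cc.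
  rewrite -(Rintegral_itvB (iG 0 t)) ?bnd_simp//.
  by rewrite addrC subrK.
have bGst : bmf (fun w => \int[leb]_(q in `[s, t]) G (q, w)).
  apply: (bmf_partial_integral (m2 := leb) _ _
    (f := fun z : Omega * R => G (z.2, z.1))) => //.
    exact: leb_itvcc_fin.
  by apply: bmf_comp bG; apply/measurable_fun_pair.
have bX u : bmf (fun w => h (X u w)) := bmf_comp (measurable_funPT (X u)) (bmf_tf _ _ _).
rewrite [X in X == 0](_ : _ = \int[P]_(w in A)
   (h (X s w) - h (X t w) + \int[leb]_(q in `[s, t]) G (q, w))); last first.
  by apply: eq_Rintegral => w _; rewrite !dynkinE// splitG; ring.
rewrite (bmf_RintD mA Aoo (bmfB (bX s) (bX t)) bGst) (bmf_RintB mA Aoo (bX s) (bX t)).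
have -> : \int[P]_(w in A) \int[leb]_(q in `[s, t]) G (q, w) =
    \int[leb]_(q in `[s, t]) (psi q - g * phi q).
  rewrite -(bmf_Fubini (m1 := leb) (m2 := P)) => //; last exact: leb_itvcc_fin.
  apply: eq_Rintegral => q _; rewrite /psi /phi /G.
  rewrite (bmf_RintB mA Aoo (bmf_section1 bjump q) (bmfZ g (bmf_section1 bhY q))).
  by rewrite (bmf_RintZ mA Aoo g (bmf_section1 bhY q)).
rewrite /phi !ger0_norm// => /eqP eq0; apply/esym/eqP.
by rewrite -subr_eq0 addrAC eq0.
Qed.

(** [discount g t r] is exactly the eigenvalue of the shift by [t - r], so multiplying by it amounts
    to composing [h] with the flow, under the jump operator too. *)
Lemma mild_tf t : s <= t ->
  \int[P]_(w in A) h (X t w) = \int[P]_(w in A) h (shift_state (t - s) (X s w))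
  + \int[leb]_(r in `[s, t]) \int[P]_(w in A) jump_shift a b Y t h (r, w).
Proof.
move=> st; have t0 : 0 <= t by exact: le_trans st.
have g0 : 0 <= g by exact: ler0n.
have := integrating_factor g0 st bphi bpsi (fun r sr _ => phi_eq sr).
rewrite {1 2}/phi !ger0_norm// => ->.
have hshift u x : h (shift_state u x) = expR (- (g * `|u|)) * h x.
  by rewrite /h /shift_state tf_flow.
congr (_ + _).
  rewrite -(bmf_RintZ mA Aoo); last exact: bmf_comp (measurable_funPT (X s)) (bmf_tf _ _ _).
  by apply: eq_Rintegral => w _; rewrite hshift.
apply: eq_Rintegral => r _; rewrite /psi -(bmf_RintZ mA Aoo).
  apply: eq_Rintegral => w _; rewrite /jump_shift /= -jump_opZ; congr jump_op.
  by apply/funext => x; rewrite hshift.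
exact: (bmf_section1 bjump).
Qed.
End test.

Theorem mild s t A h : 0 <= s -> s <= t -> natural_filtration X s A -> bmf h ->
  \int[P]_(w in A) h (X t w) = \int[P]_(w in A) h (shift_state (t - s) (X s w))
  + \int[leb]_(r in `[s, t]) \int[P]_(w in A) jump_shift a b Y t h (r, w).
Proof.
move=> s0 st FA bh; have t0 : 0 <= t by exact: le_trans st.
have mA := natural_filtration_measurable FA.
have Aoo : (P A < +oo)%E by rewrite (le_lt_trans (probability_le1 _ mA))// ltry.
apply/eqP; rewrite -subr_eq0; apply/eqP.
pose T (f : state R -> R) := \int[P]_(w in A) f (X t w) +
  - (\int[P]_(w in A) f (shift_state (t - s) (X s w)) +
  \int[leb]_(r in `[s, t]) \int[P]_(w in A) jump_shift a b Y t f (r, w)).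
have eval (F : Omega -> state R) : measurable_fun setT F ->
    normal_functional (fun f => \int[P]_(w in A) f (F w)).
  move=> mF.
  have := normal_functional_int (m := P) mA Aoo (normal_op_eval (bmf_cst _ 1) mF).
  by under eq_fun do under eq_Rintegral do rewrite mul1r.
suff nT : normal_functional T.
  apply: (normal_tf_eq0 nT) bh => n i j; apply/eqP; rewrite subr_eq0; apply/eqP.
  exact: mild_tf.
apply: normal_functionalD; first exact: eval (measurable_funPT (X t)).
apply: normal_functionalN; apply: normal_functionalD.
  apply: eval.
  have mp : measurable_fun setT (fun w => (t - s, X s w)).
    by apply/measurable_fun_pair => //; exact: measurable_funPT.
  exact: measurableT_comp measurable_shift mp.
have nOp : normal_op (fun f r => \int[P]_(w in A) jump_shift a b Y t f (r, w)).
  by apply: normal_op_int => //; exact: normal_jump_shift.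
(* [lebesgue_measure] lives on [measurableTypeR R], whose display differs from
   that of the default measurable structure on [R]. *)
have nOp' : normal_op (Z := measurableTypeR R)
    (fun f r => \int[P]_(w in A) jump_shift a b Y t f (r, w)).
  by split; [exact: (normal_op_bmf nOp)|exact: (normal_op_bound nOp)|
    exact: (normal_op_at nOp)].
exact: (normal_functional_int (m := leb) (measurable_itv _) (leb_itvcc_fin s t) nOp').
Qed.

End mild_formula.

(** * Contraction and uniqueness *)

Section comparison.
Context {R : realType} d1 d2 (Omega1 : measurableType d1) (Omega2 : measurableType d2).
Variables (P1 : probability Omega1 R) (P2 : probability Omega2 R).
Variables (X1 : R -> {RV P1 >-> state R}) (X2 : R -> {RV P2 >-> state R}).
Variables (lamp lamm : R -> state R -> state R -> R).
Hypotheses (lamp_adm : admissible lamp) (lamm_adm : admissible lamm).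
Hypothesis process1 : process_with_intensities X1 lamp lamm.
Hypothesis process2 : process_with_intensities X2 lamp lamm.
Notation leb := (@lebesgue_measure R).

(** Total variation distance, in dual form, between the laws at time [r] restricted to [A1] and
    [A2]; [D = 0] says that they coincide. *)
Definition close (A1 : set Omega1) (A2 : set Omega2) (r D : R) : Prop :=
  forall h : state R -> R, bmf h -> (forall x, `|h x| <= 1) ->
  `|\int[P1]_(w in A1) h (X1 r w) - \int[P2]_(w in A2) h (X2 r w)| <= D.

Let finP d (Omega : measurableType d) (P : probability Omega R) A :
  measurable A -> (P A < +oo)%E.
Proof. by move=> mA; rewrite (le_lt_trans (probability_le1 _ mA))// ltry. Qed.

Let fineP_le1 d (Omega : measurableType d) (P : probability Omega R) A :
  measurable A -> fine (P A) <= 1.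
Proof.
by move=> mA; rewrite -lee_fin fineK ?probability_le1// fin_num_measure.
Qed.

Lemma close_le A1 A2 r D D' : D <= D' -> close A1 A2 r D -> close A1 A2 r D'.
Proof. by move=> DD c h bh h1; exact: le_trans (c h bh h1) DD. Qed.

Lemma closeM A1 A2 r D M (h : state R -> R) : measurable A1 -> measurable A2 ->
  0 < M -> close A1 A2 r D -> bmf h -> (forall x, `|h x| <= M) ->
  `|\int[P1]_(w in A1) h (X1 r w) - \int[P2]_(w in A2) h (X2 r w)| <= M * D.
Proof.
move=> mA1 mA2 M0 c bh hM.
have := c (fun x => M^-1 * h x) (bmfZ _ bh).
rewrite (bmf_RintZ mA1 (finP P1 mA1) _ (bmf_comp (measurable_funPT (X1 r)) bh)).
rewrite (bmf_RintZ mA2 (finP P2 mA2) _ (bmf_comp (measurable_funPT (X2 r)) bh)).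
rewrite -mulrBr normrM gtr0_norm ?invr_gt0// ler_pdivrMl//; apply => x.
by rewrite normrM gtr0_norm ?invr_gt0// ler_pdivrMl// mulr1.
Qed.

Lemma close2 A1 A2 r : measurable A1 -> measurable A2 -> close A1 A2 r 2.
Proof.
move=> mA1 mA2 h bh h1; rewrite (le_trans (ler_normB _ _))// -[leRHS]/(1 + 1) lerD//.
  have := bmf_le_Rint mA1 (finP P1 mA1)
    (bmf_comp (measurable_funPT (X1 r)) bh) (fun w _ => h1 (X1 r w)).
  by move=> /le_trans; apply; rewrite mul1r fineP_le1.
have := bmf_le_Rint mA2 (finP P2 mA2)
    (bmf_comp (measurable_funPT (X2 r)) bh) (fun w _ => h1 (X2 r w)).
by move=> /le_trans; apply; rewrite mul1r fineP_le1.
Qed.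

Let cX1 w : cadlag (fun t => X1 t w). Proof. by case: process1. Qed.
Let cX2 w : cadlag (fun t => X2 t w). Proof. by case: process2. Qed.

Variable K : R.
Hypotheses (K0 : 0 < K) (lampK : forall u, `|lam0 lamp u| <= K)
  (lammK : forall u, `|lam0 lamm u| <= K).

(** The rate as a function of its law argument is a test function bounded by [K], so intensities are
    Lipschitz in the law. *)
Lemma Lam_close lam r D x : admissible lam -> (forall u, `|lam0 lam u| <= K) ->
  0 <= r -> close setT setT r D -> `|Lam X1 lam (r, x) - Lam X2 lam (r, x)| <= K * D.
Proof.
move=> adm lK r0 c; rewrite /Lam /= (ger0_norm r0).
exact: (closeM measurableT measurableT K0 c
  (bmf_section1 (bmf_lam0 adm) (r, x)) (fun y => lK (r, x, y))).
Qed.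

(** Two jump terms, each a rate of size at most [M] times an increment of size at most 2. *)
Lemma jump_op_bound (a b : R * state R -> R) h z M : 0 <= M ->
  `|a z| <= M -> `|b z| <= M -> (forall x, `|h x| <= 1) -> `|jump_op a b h z| <= 4 * M.
Proof.
move=> M0 az bz h1; rewrite /jump_op (le_trans (ler_normD _ _))//.
have hh x y : `|h x - h y| <= 2.
  by rewrite (le_trans (ler_normB _ _))// -[leRHS]/(1 + 1) lerD.
have -> : 4 * M = M * 2 + 1 * (M * 2) by ring.
rewrite lerD// !normrM ?ler_pM//.
by rewrite /busy; case: (0 < _)%N; rewrite ?normr1 ?normr0.
Qed.

(** The flow terms cancel since the restricted laws agree at [s]. The jump terms differ by
    [4 * K * D] from changing the restricted law and by [4 * (K * D)] from changing the intensities,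
    at each time of the window. *)
Lemma window_step s t A1 A2 D : 0 <= s -> s <= t -> 0 <= D ->
  natural_filtration X1 s A1 -> natural_filtration X2 s A2 ->
  close A1 A2 s 0 ->
  (forall r, s <= r <= t -> close A1 A2 r D) ->
  (forall r, s <= r <= t -> close setT setT r D) ->
  close A1 A2 t (8 * K * D * (t - s)).
Proof.
move=> s0 st D0 FA1 FA2 cs cA cT h bh h1.
have mA1 := natural_filtration_measurable FA1.
have mA2 := natural_filtration_measurable FA2.
rewrite (mild lamp_adm lamm_adm process1 s0 st FA1 bh).
rewrite (mild lamp_adm lamm_adm process2 s0 st FA2 bh).
set a1 := Lam X1 lamp; set b1 := Lam X1 lamm.
set a2 := Lam X2 lamp; set b2 := Lam X2 lamm.
pose J1 (r : R) := \int[P1]_(w in A1)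
  jump_shift a1 b1 (fun z => X1 `|z.1| z.2) t h (r, w).
pose J2 (r : R) := \int[P2]_(w in A2)
  jump_shift a2 b2 (fun z => X2 `|z.1| z.2) t h (r, w).
have ba1 : bmf a1 by exact: bmf_Lam.
have bb1 : bmf b1 by exact: bmf_Lam.
have ba2 : bmf a2 by exact: bmf_Lam.
have bb2 : bmf b2 by exact: bmf_Lam.
have bsh u : bmf (fun x => h (shift_state u x)).
  apply: bmf_comp bh.
  have mp : measurable_fun setT (fun x : state R => (u, x)) by exact/measurable_fun_pair.
  exact: measurableT_comp measurable_shift mp.
have bJ1 : bmf J1.
  apply: (bmf_partial_integral mA1 (finP P1 mA1)).
  by apply: (normal_op_bmf (normal_jump_shift _ ba1 bb1 (joint_measurable cX1))).
have bJ2 : bmf J2.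
  apply: (bmf_partial_integral mA2 (finP P2 mA2)).
  by apply: (normal_op_bmf (normal_jump_shift _ ba2 bb2 (joint_measurable cX2))).
have lst := leb_itvcc_fin s t.
have E0 : \int[P1]_(w in A1) h (shift_state (t - s) (X1 s w)) =
    \int[P2]_(w in A2) h (shift_state (t - s) (X2 s w)).
  apply/eqP; rewrite -subr_eq0 -normr_le0.
  by apply: (cs (fun x => h (shift_state (t - s) x))).
rewrite E0 opprD addrACA subrr add0r -(bmf_RintB (m := leb) _ lst bJ1 bJ2)//.
have -> : t - s = fine (leb `[s, t]).
  rewrite lebesgue_measure_itv /= lte_fin.
  by case: ltP => //= ts; apply/eqP; rewrite subr_eq0 eq_le st ts.
apply: (bmf_le_Rint (m := leb)) => //; first exact: bmfB.
move=> r /=; rewrite in_itv /= => srt; have /andP[sr rt] := srt.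
have r0 : 0 <= r by exact: le_trans sr.
pose f x := h (shift_state (t - r) x).
have f1 x : `|f x| <= 1 by exact: h1.
pose j1 x := jump_op a1 b1 f (r, x); pose j2 x := jump_op a2 b2 f (r, x).
have bj1 : bmf j1 by exact: bmf_section1 (bmf_jump_op ba1 bb1 (bsh _)) r.
have bj2 : bmf j2 by exact: bmf_section1 (bmf_jump_op ba2 bb2 (bsh _)) r.
have J1E : J1 r = \int[P1]_(w in A1) j1 (X1 r w).
  by rewrite /J1 /jump_shift /= ger0_norm.
have J2E : J2 r = \int[P2]_(w in A2) j2 (X2 r w).
  by rewrite /J2 /jump_shift /= ger0_norm.
rewrite J1E J2E.
have bjX (j : state R -> R) : bmf j -> bmf (fun w => j (X2 r w)).
  exact: bmf_comp (measurable_funPT (X2 r)).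
(* The intermediate term applies the rates of the first process to the law of the second. *)
rewrite (_ : _ - _ = (\int[P1]_(w in A1) j1 (X1 r w) - \int[P2]_(w in A2) j1 (X2 r w))
    + \int[P2]_(w in A2) (j1 (X2 r w) - j2 (X2 r w))); last first.
  by rewrite (bmf_RintB mA2 (finP P2 mA2) (bjX _ bj1) (bjX _ bj2)); ring.
have -> : 8 * K * D = 4 * K * D + 4 * (K * D) by ring.
rewrite (le_trans (ler_normD _ _))// lerD//.
  apply: closeM => //; first by rewrite mulr_gt0.
    exact: cA.
  by move=> x; apply: jump_op_bound => //; [exact: ltW|exact: Lam_bound|exact: Lam_bound].
apply: (@le_trans _ _ (4 * (K * D) * fine (P2 A2))); last first.
  by rewrite ler_piMr ?fineP_le1// !mulr_ge0// ltW.
apply: bmf_le_Rint => //; first exact: finP.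
  by apply: bmfB; exact: bjX.
move=> w _; rewrite (_ : _ - _ =
    jump_op (fun z => a1 z - a2 z) (fun z => b1 z - b2 z) f (r, X2 r w)); last first.
  by rewrite /j1 /j2 /jump_op; ring.
apply: jump_op_bound => //; first by rewrite mulr_ge0// ltW.
  by apply: Lam_close => //; exact: cT.
by apply: Lam_close => //; exact: cT.
Qed.

(** Chosen so that [8 * K * delta] is one half. *)
Let delta := (16 * K)^-1.

(** The a priori bound 2 is halved at every pass through [window_step]. The last hypothesis turns a
    bound for the restricted laws into one for the full laws, which govern the intensities. *)
Lemma window s A1 A2 : 0 <= s ->
  natural_filtration X1 s A1 -> natural_filtration X2 s A2 ->
  close A1 A2 s 0 ->
  (forall D, 0 <= D -> (forall r, s <= r <= s + delta -> close A1 A2 r D) ->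
    forall r, s <= r <= s + delta -> close setT setT r D) ->
  forall r, s <= r <= s + delta -> close A1 A2 r 0.
Proof.
move=> s0 FA1 FA2 cs AT.
have mA1 := natural_filtration_measurable FA1.
have mA2 := natural_filtration_measurable FA2.
have halving n r : s <= r <= s + delta -> close A1 A2 r (2 / 2 ^+ n).
  elim: n r => [|n ih] r sr; first by rewrite expr0 divr1; exact: close2.
  have D0 : 0 <= 2 / 2 ^+ n :> R by rewrite divr_ge0// exprn_ge0.
  have /andP[sr1 sr2] := sr.
  have sub q : s <= q <= r -> s <= q <= s + delta.
    by move=> /andP[-> qr]; rewrite (le_trans qr).
  apply: close_le (window_step s0 sr1 D0 FA1 FA2 cs (fun q sq => ih q (sub q sq)) _).
    have -> : 8 * K * (2 / 2 ^+ n) * (r - s) = (2 / 2 ^+ n) * (8 * K * (r - s)) by ring.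
    have -> : 2 / 2 ^+ n.+1 = 2 / 2 ^+ n * 2^-1 :> R by rewrite exprSr invfM mulrA.
    rewrite ler_wpM2l//.
    have : r - s <= delta by rewrite lerBlDl.
    have K8 : 0 < 8 * K by rewrite mulr_gt0.
    have dE : delta = 2^-1 / (8 * K).
      by rewrite /delta -invfM; congr _^-1; ring.
    by rewrite dE ler_pdivlMr// mulrC.
  by move=> q sq; apply: (AT _ D0 ih); exact: sub.
move=> r sr h bh h1; set x := `|_|.
have : 2 / 2 ^+ n @[n --> \oo] --> (2 * 0 : R).
  apply: cvgM; first exact: cvg_cst.
  under eq_fun do rewrite -exprVn.
  by apply: cvg_expr; rewrite ger0_norm// invf_lt1// ltr1n.
rewrite mulr0 => two0.
rewrite -(cvg_lim _ two0)//; apply: limr_ge; first exact: cvgP two0.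
by apply: nearW => n; exact: halving.
Qed.

(** The disjunction covers both uses: sure events, where restricted and full laws are the same, and
    past events once the one-dimensional laws are known to agree. *)
Lemma propagate s A1 A2 : 0 <= s ->
  natural_filtration X1 s A1 -> natural_filtration X2 s A2 ->
  close A1 A2 s 0 ->
  (A1 = setT /\ A2 = setT) \/ (forall r, 0 <= r -> close setT setT r 0) ->
  forall t, s <= t -> close A1 A2 t 0.
Proof.
move=> s0 FA1 FA2 cs AT.
have d0 : 0 < delta by rewrite invr_gt0 mulr_gt0.
have filtration_mono d (Omega : measurableType d) (P : probability Omega R)
    (X : R -> {RV P >-> state R}) u v A : u <= v ->
    natural_filtration X u A -> natural_filtration X v A.
  move=> uv; apply: sub_smallest2r.
    exact: smallest_sigma_algebra.
  move=> B [q /=]; rewrite in_itv /= => /andP[q0 qu] XB; exists q => //.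
  by rewrite /= in_itv /= q0 (le_trans qu).
have steps n t : s <= t <= s + n%:R * delta -> close A1 A2 t 0.
  elim: n t => [|n ih] t.
    by rewrite mul0r addr0 => st; rewrite (_ : t = s)//; apply/eqP; rewrite eq_le andbC.
  have [tn /andP[st _]|nt /andP[st tn]] := leP t (s + n%:R * delta).
    by apply: ih; rewrite st.
  have sn : s <= s + n%:R * delta by rewrite lerDl mulr_ge0// ltW.
  apply: (window (le_trans s0 sn)).
  - exact: filtration_mono FA1.
  - exact: filtration_mono FA2.
  - by apply: ih; rewrite sn lexx.
  - move=> D D0 cD r sr; case: AT => [[A1T A2T]|cT].
      by rewrite -A1T -A2T; exact: cD.
    apply: close_le D0 _; apply: cT; case/andP: sr => sr _.
    by rewrite (le_trans s0)// (le_trans sn).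
  - by rewrite ltW//= -addrA -[X in _ + X](_ : n.+1%:R * delta = _)// -natr1 mulrDl mul1r.
move=> t st; apply: (steps (Num.truncn ((t - s) / delta)).+1); rewrite st/=.
rewrite -lerBlDl -ler_pdivrMr//.
have ts0 : 0 <= (t - s) / delta by rewrite divr_ge0 ?subr_ge0// ltW.
by have /andP[_ /ltW] := truncn_itv ts0.
Qed.

End comparison.

(** * Cylinder events *)

Section finite_dimensional.
Context {R : realType}.

(** The constraints are indexed by time, not by position in the list, so order and repetitions in
    [l] are immaterial and [l] may be sorted. *)
Definition cylinder (l : seq {nonneg R}) (B : {nonneg R} -> set (state R)) :
    set ({nonneg R} -> state R) := [set w | forall t, t \in l -> B t (w t)].

Definition cylinders : set (set ({nonneg R} -> state R)) :=
  [set C | exists l B, (forall t, measurable (B t)) /\ C = cylinder l B].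

Lemma cylinders_setI : setI_closed cylinders.
Proof.
move=> _ _ [l [B [mB ->]]] [l' [B' [mB' ->]]].
pose D t := (if t \in l then B t else setT) `&` (if t \in l' then B' t else setT).
exists (l ++ l'), D; split; first by move=> t; apply: measurableI; case: ifP.
apply/seteqP; split => w /=.
  move=> [wB wB'] t _; split; case: ifP => // tl; [exact: wB|exact: wB'].
move=> wD; split => t tl; have := wD t; rewrite mem_cat tl ?orbT /D tl.
  by move=> /(_ isT)[].
by move=> /(_ isT)[].
Qed.

Lemma path_measurable_cylinders : path_measurable `<=` <<s cylinders>>.
Proof.
apply: sub_smallest2r; first exact: smallest_sigma_algebra.
move=> _ [t _ [B mB <-]]; exists [:: t], (fun=> B); split => //.
apply/seteqP; split => w /=; first by move=> [_ wB] u /[!inE] /eqP ->.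
by move=> wB; split => //; apply: wB; rewrite inE.
Qed.

Context d (Omega : measurableType d) (P : probability Omega R).
Variable X : R -> {RV P >-> state R}.

Lemma cylinder_nil B : trajectory X @^-1` cylinder [::] B = setT.
Proof. by apply/seteqP; split => // w _ t. Qed.

Lemma cylinder_rcons l t B : trajectory X @^-1` cylinder (rcons l t) B =
  trajectory X @^-1` cylinder l B `&` X t%:num @^-1` B t.
Proof.
apply/seteqP; split => w /= wB.
  split=> [u ul|]; first by apply: wB; rewrite mem_rcons inE ul orbT.
  by apply: wB; rewrite mem_rcons inE eqxx.
case: wB => wB wt u; rewrite mem_rcons inE => /predU1P[->//|]; exact: wB.
Qed.

Lemma cylinder_filtration l B u : (forall t, measurable (B t)) ->
  (forall t, t \in l -> t%:num <= u) ->
  natural_filtration X u (trajectory X @^-1` cylinder l B).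
Proof.
move=> mB; elim/last_ind: l => [|l t ih] lu.
  by rewrite cylinder_nil; exact: (@measurableT _ (g_sigma_algebraType _)).
rewrite cylinder_rcons; apply: (@measurableI _ (g_sigma_algebraType _)).
  by apply: ih => v vl; apply: lu; rewrite mem_rcons inE vl orbT.
apply: sub_sigma_algebra; exists t%:num => /=; last by exists (B t) => //; rewrite setTI.
by rewrite in_itv /= ge0 lu// mem_rcons inE eqxx.
Qed.

Lemma seq_bound (l : seq {nonneg R}) :
  exists2 u : R, 0 <= u & forall t, t \in l -> t%:num <= u.
Proof.
elim: l => [|t l [u u0 lu]]; first by exists 0.
exists (u + t%:num); first by rewrite addr_ge0.
by move=> v; rewrite inE => /predU1P[->|/lu vu]; rewrite ?lerDr// (le_trans vu)// lerDl.
Qed.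

Lemma measurable_cylinder l B : (forall t, measurable (B t)) ->
  measurable (trajectory X @^-1` cylinder l B).
Proof.
move=> mB; have [u _ lu] := seq_bound l.
exact: natural_filtration_measurable (cylinder_filtration mB lu).
Qed.

End finite_dimensional.

Section uniqueness.
Context {R : realType} d1 d2 (Omega1 : measurableType d1) (Omega2 : measurableType d2).
Variables (P1 : probability Omega1 R) (P2 : probability Omega2 R).
Variables (X1 : R -> {RV P1 >-> state R}) (X2 : R -> {RV P2 >-> state R}).
Variables (lamp lamm : R -> state R -> state R -> R).
Hypotheses (lamp_adm : admissible lamp) (lamm_adm : admissible lamm).
Hypothesis process1 : process_with_intensities X1 lamp lamm.
Hypothesis process2 : process_with_intensities X2 lamp lamm.
Hypothesis init : forall A, measurable A ->
  distribution P1 (X1 0) A = distribution P2 (X2 0) A.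

Let common_bound : exists2 K : R, 0 < K &
  (forall u, `|lam0 lamp u| <= K) /\ (forall u, `|lam0 lamm u| <= K).
Proof.
have [_ [K1 h1]] := bmf_lam0 lamp_adm; have [_ [K2 h2]] := bmf_lam0 lamm_adm.
exists (`|K1| + `|K2| + 1); first by rewrite ltr_pwDr// addr_ge0.
have := ler_norm K1; have := ler_norm K2; have := normr_ge0 K1; have := normr_ge0 K2.
by move=> *; split => u; [have := h1 u|have := h2 u]; lra.
Qed.

Lemma close_marginal r : 0 <= r -> close X1 X2 setT setT r 0.
Proof.
move=> r0; have [K K0 [h1 h2]] := common_bound.
apply: (propagate lamp_adm lamm_adm process1 process2 K0 h1 h2 (lexx 0)) r0.
- exact: (@measurableT _ (g_sigma_algebraType _)).
- exact: (@measurableT _ (g_sigma_algebraType _)).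
- move=> h bh _; rewrite normr_le0 subr_eq0; apply/eqP.
  have E d (Omega : measurableType d) (P : probability Omega R)
      (X : {RV P >-> state R}) :
      \int[P]_w h (X w) = \int[distribution P X]_x h x.
    have Poo : (P setT < +oo)%E by rewrite probability_setT ltry.
    rewrite /Rintegral integral_distribution//=.
      by apply/measurable_EFinP; case: bh.
    exact: (bmf_integrable measurableT Poo (bmf_comp (measurable_funPT X) bh)).
  rewrite !E /Rintegral; congr fine; apply: eq_measure_integral => A mA _.
  exact: init.
- by left.
Qed.

(** Induction on the latest time [t]: adding the constraint at [t] replaces [h] by [\1_(B t) * h],
    still bounded by 1, so the shorter cylinder gives agreement at [t]. The extended cylinder
    belongs to the past of [t], and agreement propagates to [u]. The final time [u] is left free so
    that the hypothesis can be used at [t]. *)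
Lemma close_cylinder l B u :
  pairwise (fun s t : {nonneg R} => s%:num <= t%:num) l ->
  (forall t, measurable (B t)) -> 0 <= u -> (forall t, t \in l -> t%:num <= u) ->
  close X1 X2 (trajectory X1 @^-1` cylinder l B) (trajectory X2 @^-1` cylinder l B) u 0.
Proof.
have [K K0 [h1 h2]] := common_bound.
move=> + mB; elim/last_ind: l u => [|l t ih] u lP u0 lu.
  by rewrite !cylinder_nil; exact: close_marginal.
move: lP; rewrite pairwise_rcons => /andP[/allP lt lP].
have tu : t%:num <= u by apply: lu; rewrite mem_rcons inE eqxx.
have lt' v : v \in rcons l t -> v%:num <= t%:num.
  by rewrite mem_rcons inE => /predU1P[->//|/lt].
apply: (propagate lamp_adm lamm_adm process1 process2 K0 h1 h2 _ _ _ _ _ tu) => //.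
- exact: cylinder_filtration.
- exact: cylinder_filtration.
- move=> h bh h1'; rewrite !cylinder_rcons.
  have b1 : bmf (fun x => \1_(B t) x * h x).
    by apply: bmfM => //; exact: bmf_indic.
  have cut d (Omega : measurableType d) (P : probability Omega R)
      (X : R -> {RV P >-> state R}) A :
      \int[P]_(w in A `&` X t%:num @^-1` B t) h (X t%:num w) =
      \int[P]_(w in A) (\1_(B t) (X t%:num w) * h (X t%:num w)).
    rewrite Rintegral_mkcondr; apply: eq_Rintegral => w _; rewrite patchE indicE.
    have [XB|XB] := pselect (B t (X t%:num w)).
      by rewrite !mem_set// mul1r.
    by rewrite !memNset// mul0r.
  rewrite !cut; apply: (ih t%:num lP _ lt _ b1) => // x.
  rewrite normrM mulr_ile1// indicE.
  by case: (x \in B t); rewrite ?normr1 ?normr0.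
- by right; exact: close_marginal.
Qed.

Lemma cylinder_probability l B : (forall t, measurable (B t)) ->
  P1 (trajectory X1 @^-1` cylinder l B) = P2 (trajectory X2 @^-1` cylinder l B).
Proof.
move=> mB.
pose l' := sort (fun s t : {nonneg R} => s%:num <= t%:num) l.
have cE : cylinder l B = cylinder l' B.
  by apply/seteqP; split => w wB t tl; apply: wB; move: tl; rewrite mem_sort.
rewrite cE.
have lP : pairwise (fun s t : {nonneg R} => s%:num <= t%:num) l'.
  rewrite -sorted_pairwise; first by apply: sort_sorted => s t; exact: le_total.
  by move=> ? ? ?; exact: le_trans.
have [u u0 lu] := seq_bound l'.
(* The test function 1 recovers the probabilities of the cylinders. *)
have := close_cylinder lP mB u0 lu (bmf_cst _ 1).
rewrite normr1 => /(_ (fun=> lexx 1)).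
have m1 := measurable_cylinder X1 l' mB; have m2 := measurable_cylinder X2 l' mB.
rewrite !Rintegral_cst// !mul1r normr_le0 subr_eq0 => /eqP P12.
by rewrite -[LHS]fineK ?fin_num_measure// P12 fineK ?fin_num_measure.
Qed.

Theorem path_law_unique A : path_measurable A ->
  P1 (trajectory X1 @^-1` A) = P2 (trajectory X2 @^-1` A).
Proof.
move=> /path_measurable_cylinders.
rewrite -(setI_closed_g_dynkin_g_sigma_algebra cylinders_setI).
(* Measurability of both preimages is carried along, as complements and countable unions need it to
   compute probabilities. *)
pose H := [set A | [/\ measurable (trajectory X1 @^-1` A),
  measurable (trajectory X2 @^-1` A) &
  P1 (trajectory X1 @^-1` A) = P2 (trajectory X2 @^-1` A)]].
suff : <<d cylinders >> `<=` H by move=> HH /HH[].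
apply: smallest_sub.
- split.
  + by rewrite /H /= !preimage_setT !probability_setT.
  + move=> C [m1 m2 PC]; split.
    * exact: (measurableC m1).
    * exact: (measurableC m2).
    * have := probability_setC P1 m1; have := probability_setC P2 m2.
      by rewrite PC => <-.
  + move=> F tF HF.
    have tpre d (Omega : measurableType d) (P : probability Omega R)
        (X : R -> {RV P >-> state R}) :
        trivIset setT (fun k => trajectory X @^-1` F k).
      apply/trivIsetP => i j _ _ ij; rewrite -preimage_setI.
      by have /trivIsetP -> := tF; rewrite ?preimage_set0.
    rewrite /H /= !preimage_bigcup; split.
    * by apply: bigcupT_measurable => k; case: (HF k).
    * by apply: bigcupT_measurable => k; case: (HF k).
    * rewrite !measure_bigcup//.
      - by apply: eq_eseriesr => k _; case: (HF k).
      - by move=> k _; case: (HF k).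
      - exact: tpre.
      - by move=> k _; case: (HF k).
      - exact: tpre.
- move=> _ [l [B [mB ->]]]; split.
  + exact: measurable_cylinder.
  + exact: measurable_cylinder.
  + exact: cylinder_probability.
Qed.

End uniqueness.

Theorem theorem2 (R : realType)
  (lamp lamm : R -> state R -> state R -> R)
  (lamp_adm : admissible lamp) (lamm_adm : admissible lamm)
  (c : R) (c_gt0 : 0 < c)
  (lamp_lb : forall (t : R) X Y, 0 <= t -> c <= lamp t X Y)
  (lamm_lb : forall (t : R) X Y, 0 <= t -> (0 < customers X)%N -> c <= lamm t X Y)
  (lamm_idle : forall (t : R) (x : {nonneg R}) Y, 0 <= t -> lamm t (Idle x) Y = 0)
  (nu : probability (state R) R)
  (d1 d2 : measure_display)
  (Omega1 : measurableType d1) (Omega2 : measurableType d2)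
  (P1 : probability Omega1 R) (P2 : probability Omega2 R)
  (X1 : R -> {RV P1 >-> state R}) (X2 : R -> {RV P2 >-> state R})
  (process1 : process_with_intensities X1 lamp lamm)
  (process2 : process_with_intensities X2 lamp lamm)
  (init1 : forall A : set (state R), measurable A ->
     distribution P1 (X1 0) A = nu A)
  (init2 : forall A : set (state R), measurable A ->
     distribution P2 (X2 0) A = nu A) :
  forall A : set ({nonneg R} -> state R), path_measurable A ->
    P1 (trajectory X1 @^-1` A) = P2 (trajectory X2 @^-1` A).
Proof.
apply: (path_law_unique lamp_adm lamm_adm process1 process2) => A mA.
by rewrite init1// init2.
Qed.
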